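(* Let $\sigma>0$, $I=(0,\sigma)$, and let $u\in W^{1,\infty}(0,\sigma)$ be convex on $I$ (so that $u''\ge0$). Let $\{x_1,x_2,x_3\}\subset\mathrm{supp}(u'')$ with $0<x_1<x_2<x_3<\sigma$, and let $\varphi$ be the hat function associated with the nodes $x_1,x_2,x_3$. (i) There exists a sequence $(\varphi_k)$ in $H^1_0(0,\sigma)$, of functions preserving the convexity of $u$ and compactly supported in $(0,\sigma)$, converging in $H^1(0,\sigma)$ to $\varphi$. (ii) Assume that $x_2$ is an accumulation point of $\mathrm{supp}(u'')$. Then there exist two sequences $(\varphi_k^-)$ and $(\varphi_k^+)$ in $H^1_0(0,\sigma)$, of functions preserving the convexity of $u$ and compactly supported in $(0,\sigma)$, converging in $L^1(0,\sigma)$ respectively to $\varphi\mathbf{1}_{(x_1,x_2)}$ and $\varphi\mathbf{1}_{(x_2,x_3)}$.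
   Context: A function $v:I\to\mathbb{R}$ preserves the convexity of the convex function $u:I\to\mathbb{R}$ if there exists $t_0>0$ such that $u+tv$ is convex on $I$ for every $t\in[-t_0,t_0]$. The hat function associated with nodes $x_1<x_2<x_3$ is $\varphi\in W^{1,\infty}(I)$ with $\varphi(x)=\frac{x-x_1}{x_2-x_1}$ on $[x_1,x_2]$, $\varphi(x)=\frac{x_3-x}{x_3-x_2}$ on $[x_2,x_3]$, and $\varphi=0$ on $I\setminus(x_1,x_3)$. $u''$ is the distributional second derivative (a nonnegative measure on $I$) and $\mathrm{supp}(u'')$ is its support; $\mathbf{1}_A$ is the indicator function of $A$. *)

(* Defs.v *)
From HB Require Import structures.
From mathcomp Require Import all_boot all_order all_algebra.
From mathcomp Require Import all_classical all_reals all_analysis.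

Set Implicit Arguments.
Unset Strict Implicit.
Unset Printing Implicit Defensive.

Import Order.TTheory GRing.Theory Num.Theory.
Import numFieldNormedType.Exports.

Local Open Scope classical_set_scope.
Local Open Scope ring_scope.

(* Functions on an open set D of the line are functions R -> R of which only
   the values on D matter; f \_ D is the extension of f by 0 outside D. *)

Section Lp_spaces.
Context {R : realType}.
Implicit Types (D : set R) (p : \bar R) (f : R -> R).

Definition Lp D p f : Prop := f \_ D \in Lfun (@lebesgue_measure R) p.

Definition Lp_cvg D p (f_ : nat -> R -> R) f : Prop :=
  [/\ forall k, Lp D p (f_ k), Lp D p f &
      'N[@lebesgue_measure R]_p[EFin \o ((f_ k \- f)%R \_ D)]%E @[k --> \oo]
        --> 0%E].

End Lp_spaces.

Section distributions.
Context {R : realType}.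
Implicit Types (D : set R) (f g psi : R -> R).

Definition compactly_supported D f : Prop :=
  compact (closure [set x | f x != 0]) /\ closure [set x | f x != 0] `<=` D.

Definition test_function D psi : Prop :=
  (forall n x, derivable (derive1n n psi) x 1) /\ compactly_supported D psi.

(* A distribution on D is given by its values on the test functions of D. *)
Definition regular_distribution D f psi : R :=
  \int[lebesgue_measure]_(x in D) (f x * psi x).

Definition distributional_derivative (T : (R -> R) -> R) psi : R :=
  - T (derive1 psi).

(* The points of D without any open neighbourhood on which T vanishes. *)
Definition distribution_support D (T : (R -> R) -> R) : set R :=
  [set x | D x /\ forall U, open U -> U x ->
     exists2 psi, test_function (D `&` U) psi & T psi != 0].

Definition second_derivative D f : (R -> R) -> R :=
  distributional_derivative
    (distributional_derivative (regular_distribution D f)).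

Definition weak_derivative D f g : Prop :=
  [/\ locally_integrable D f, locally_integrable D g &
      forall psi, test_function D psi ->
        distributional_derivative (regular_distribution D f) psi =
        regular_distribution D g psi].

End distributions.

Section Sobolev_spaces.
Context {R : realType}.
Implicit Types (D : set R) (p : \bar R) (f : R -> R).

Definition W1p D p f : Prop :=
  Lp D p f /\ exists2 g, weak_derivative D f g & Lp D p g.

(* Weak derivatives are unique almost everywhere, so the choice of the g_ k
   and of g is immaterial. *)
Definition W1p_cvg D p (f_ : nat -> R -> R) f : Prop :=
  Lp_cvg D p f_ f /\
  exists (g_ : nat -> R -> R) g, [/\ forall k, weak_derivative D (f_ k) (g_ k),
                   weak_derivative D f g & Lp_cvg D p g_ g].

(* The closure in W^{1,p}(D) of the test functions of D. *)
Definition W1p_0 D p f : Prop :=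
  exists2 psi_ : nat -> R -> R, (forall k, test_function D (psi_ k)) & W1p_cvg D p psi_ f.

Definition H1_cvg D (f_ : nat -> R -> R) f : Prop := W1p_cvg D 2%:E f_ f.

Definition H1_0 D f : Prop := W1p_0 D 2%:E f.

End Sobolev_spaces.

Section convexity.
Context {R : realType}.
Implicit Types (D : set R) (u v : R -> R).

Definition convex_on D u : Prop := convex_function D u.

Definition preserves_convexity D u v : Prop :=
  exists2 t0 : R, 0 < t0 &
    forall t, t \in `[- t0, t0] -> convex_on D (fun x => u x + t * v x).

Definition hat (x1 x2 x3 x : R) : R :=
  if x1 <= x <= x2 then (x - x1) / (x2 - x1)
  else if x2 <= x <= x3 then (x3 - x) / (x3 - x2)
  else 0.

End convexity.

(* Main.v *)
Require Import Defs.
From HB Require Import structures.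
From mathcomp Require Import all_boot all_order all_algebra.
From mathcomp Require Import all_classical all_reals all_analysis.
From mathcomp Require Import measurable_realfun ring lra.

Set Implicit Arguments.
Unset Strict Implicit.
Unset Printing Implicit Defensive.

Import Order.TTheory GRing.Theory Num.Theory.
Import numFieldNormedType.Exports.

Local Open Scope classical_set_scope.
Local Open Scope ring_scope.

(** Let s be the left derivative of u: it is nondecreasing, left-continuous,
    and a subgradient of u.  Write d_f(x, y) = f(y) - f(x) - g(x) (y - x) for
    the Bregman divergence of a function f with derivative g.  A function is
    convex as soon as its divergence is nonnegative, so v preserves the
    convexity of u as soon as |d_v| <= C d_u for some C.  This condition is
    linear in v, so it passes to linear combinations
    ([dominated_bregman_preserves_convexity]).

    Take a < b with s(a) < s(b), and continue u outside [a, b] by its tangents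
    at a and at b.  This amounts to clamping the argument of s to [a, b], which
    loses divergence: 0 <= d <= d_u.  After subtraction of the tangent at a
    and division by s(b) - s(a) one gets a convex function which vanishes
    left of a and is equal to x - m right of b, with a <= m <= b: a
    regularized ramp max(x - m, 0) satisfying the domination
    ([exists_ramp]).  In terms of measures, its second derivative is the
    normalized restriction of u'' to an interval, and m is its barycenter.

    If x lies in the support of u'', then s(a) < s(b) whenever a < x < b, for
    otherwise u would be affine on ]a, b[ and u'' would vanish there
    ([support_subgradient_lt]).  Regularized ramps at three points of the
    support, over tiny intervals, combine like the three ramps of a hat
    function.  The combination vanishes outside the three intervals and what
    they enclose, hence has compact support; it is close to the hat with nodes
    m1 < m2 < m3, with the same derivative away from the three intervals
    ([tent_approximation]).  Letting the intervals shrink gives (i), by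
    bounded convergence of the functions and of their derivatives.

    For (ii), let y be a point of the support close to x2 and distinct from
    it.  The hat with nodes x1, min(y, x2), max(y, x2) is bounded by 1 and
    converges, when y tends to x2, to the restriction of the hat to ]x1, x2[
    at every point but x2; the other half is symmetric.

    Two analytic facts are needed on the way. A bounded Lipschitz function
    strictly differentiable from the left everywhere has its left derivative
    as a weak derivative ([left_primitive_weak_derivative]): the difference
    quotients of a compactly supported function have integral 0 by
    translation invariance, and they converge boundedly. And a compactly
    supported function of this kind lies in H^1_0 ([left_primitive_H1_0]),
    by mollification with kernels supported on one side, so that left-
    continuity of the derivative gives convergence at every point. The
    kernels come for free: the support of u'' being nonempty, there are
    nonzero test functions with arbitrarily small support, and their
    squares, translated and normalized, are mollifiers
    ([support_mollifier]). *)

(** * Subgradients and the left derivative of a convex function *)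

Section subgradients.
Context {R : realType}.
Implicit Types (D : set R) (f g u s : R -> R).

Definition bregman f g (x y : R) : R := f y - f x - g x * (y - x).

Definition subgradient D f g : Prop :=
  forall x y, D x -> D y -> 0 <= bregman f g x y.

Definition left_continuous D g : Prop :=
  forall x, D x -> forall e, 0 < e ->
    exists2 d, 0 < d & forall y, D y -> x - d < y -> y <= x -> `|g y - g x| <= e.

Lemma subgradient_le D f g x y : subgradient D f g -> D x -> D y ->
  x <= y -> g x <= g y.
Proof.
move=> sg Dx Dy; rewrite le_eqVlt => /predU1P[->//|xy].
have := sg _ _ Dx Dy; have := sg _ _ Dy Dx; rewrite /bregman => h1 h2.
rewrite -subr_ge0 -(@pmulr_lge0 _ (y - x)) ?subr_gt0//; lra.
Qed.

Lemma convex_onP D f : convex_on D f <-> forall l x y, 0 <= l -> l <= 1 ->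
  D x -> D y -> f (l * x + (1 - l) * y) <= l * f x + (1 - l) * f y.
Proof.
split=> [cf l x y l0 l1 /mem_set Dx /mem_set Dy|cf t x y Dx Dy].
  exact: (cf (@Itv01 _ _ l0 l1) x y Dx Dy).
by apply: (cf t%:num); rewrite // -inE.
Qed.

Lemma subgradient_convex D f g : (forall l x y, 0 <= l -> l <= 1 -> D x -> D y ->
    D (l * x + (1 - l) * y)) -> subgradient D f g -> convex_on D f.
Proof.
move=> cD sg; apply/convex_onP => l x y l0 l1 Dx Dy.
have Dz := cD _ _ _ l0 l1 Dx Dy.
have l1' : 0 <= 1 - l by rewrite subr_ge0.
have := addr_ge0 (mulr_ge0 l0 (sg _ _ Dz Dx)) (mulr_ge0 l1' (sg _ _ Dz Dy)).
rewrite /bregman => h; rewrite -subr_ge0; apply: le_trans h _.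
by rewrite le_eqVlt; apply/orP; left; apply/eqP; ring.
Qed.

(** The left derivative, that is the supremum of the slopes of the chords ending
    at x.  It is left-continuous because a chord whose slope almost attains the
    supremum at x still bounds it from below at points slightly left of x. *)
Lemma convex_subgradient (p q : R) u : convex_on `]p, q[%classic u ->
  exists2 s, subgradient `]p, q[%classic u s & left_continuous `]p, q[%classic s.
Proof.
set D := `]p, q[%classic => cu.
have DE x : D x <-> p < x /\ x < q.
  by rewrite /D/= in_itv/=; split=> [/andP[]|[-> ->]].
have ch x y z : D x -> D z -> x < y -> y < z ->
    (u y - u x) * (z - y) <= (u z - u y) * (y - x).
  move=> Dx Dz xy yz.
  have zx : 0 < z - x by lra.
  have l0 : 0 <= (z - y) / (z - x) by rewrite divr_ge0//; lra.
  have l1 : (z - y) / (z - x) <= 1 by rewrite ler_pdivrMr//; lra.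
  have := (convex_onP _ _).1 cu _ _ _ l0 l1 Dx Dz.
  set l := (z - y) / (z - x).
  have -> : l * x + (1 - l) * z = y by rewrite /l; field; rewrite gt_eqF.
  have el : l * (z - x) = z - y by rewrite /l divfK// gt_eqF.
  rewrite -(ler_pM2r zx) => h.
  have : (l * u x + (1 - l) * u z) * (z - x) = (z - y) * u x + (y - x) * u z.
    rewrite mulrDl -!mulrA [u x * _]mulrC [u z * _]mulrC !mulrA el; congr (_ + _ * _).
    by rewrite mulrBl el; ring.
  by move=> e; rewrite e in h; lra.
pose S x := [set (u x - u y) / (x - y) | y in [set y | p < y /\ y < x]].
have S0 x : D x -> S x !=set0.
  move=> /DE[px xq]; exists ((u x - u ((p + x) / 2)) / (x - (p + x) / 2)).
  by exists ((p + x) / 2) => //=; split; lra.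
have Su x y : D x -> D y -> x < y -> ubound (S x) ((u y - u x) / (y - x)).
  move=> Dx Dy xy _ /= [z [pz zx] <-].
  have Dz : D z by apply/DE; move/DE : Dx => [] *; split; lra.
  have := ch _ _ _ Dz Dy zx xy.
  rewrite ler_pdivrMr ?subr_gt0// mulrAC ler_pdivlMr ?subr_gt0//.
have hS x : D x -> has_sup (S x).
  move=> Dx; split; first exact: S0.
  exists ((u ((x + q) / 2) - u x) / ((x + q) / 2 - x)); apply: Su => //.
    by apply/DE; move/DE : Dx => [] *; split; lra.
  by move/DE : Dx => [] *; lra.
pose s x := sup (S x).
have sl x y : D x -> p < y -> y < x -> (u x - u y) / (x - y) <= s x.
  by move=> Dx py yx; apply: (sup_upper_bound (hS _ Dx)); exists y.
have sg : subgradient D u s.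
  move=> x y Dx Dy; rewrite /bregman; have [xy|yx|->] := ltgtP x y; last by lra.
    have : s x <= (u y - u x) / (y - x) by apply: ge_sup; [exact: S0|exact: Su].
    by rewrite ler_pdivlMr ?subr_gt0//; lra.
  have : (u x - u y) / (x - y) <= s x by apply: sl => //; move/DE : Dy => [].
  by rewrite ler_pdivrMr ?subr_gt0//; lra.
exists s => // x Dx e e0.
have [_ [y [py yx] <-] sy] := sup_adherent e0 (hS _ Dx).
move: sy; rewrite -/(s x) ltr_pdivlMr ?subr_gt0// => sy.
(* h is the margin by which the chord from y to x is steeper than s x - e; the
   subgradient inequality at x keeps the chord from y to z as steep as that as
   long as x - z <= h / e. *)
pose h := u x - u y - (s x - e) * (x - y).
have h0 : 0 < h by rewrite /h subr_gt0.
exists (Num.min (x - y) (h / e)); first by rewrite lt_min subr_gt0 yx divr_gt0.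
move=> z Dz; rewrite ltrBlDr -ltrBlDl lt_min ltr_pdivlMr// => /andP[zy ze] zx.
have szx : s z <= s x by apply: subgradient_le sg _ _ _.
rewrite ler_distl; apply/andP; split; last by rewrite (le_trans szx)// lerDl ltW.
have : (u z - u y) / (z - y) <= s z by apply: sl => //; lra.
apply: le_trans; rewrite ler_pdivlMr; last lra.
have := sg x z Dx Dz; rewrite /bregman.
rewrite /h in ze.
have -> : (s x - e) * (z - y) = (s x - e) * (x - y) - s x * (x - z) + (x - z) * e by ring.
lra.
Qed.
End subgradients.

(** * Lipschitz functions with a left derivative *)

Section left_primitives.
Context {R : realType}.
Implicit Types (D : set R) (f g u s : R -> R).

(** The second condition is strict differentiability from the left: both ends
    of the increment approach x.  Unlike plain left differentiability it forces
    g to be left-continuous, and it is still linear in (f, g). *)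
Definition left_primitive f g : Prop :=
  (exists L, forall x y, `|f y - f x| <= L * `|y - x|) /\
  forall x e, 0 < e -> exists2 d, 0 < d & forall y z,
    x - d < y -> y <= z -> z <= x -> `|f z - f y - g x * (z - y)| <= e * (z - y).

Lemma left_primitiveZ c f g : left_primitive f g ->
  left_primitive (fun x => c * f x) (fun x => c * g x).
Proof.
move=> [[L fL] fg]; split.
  by exists (`|c| * L) => x y; rewrite -mulrBr normrM -mulrA ler_wpM2l.
move=> x e e0; have c1 : 0 < `|c| + 1 by rewrite ltr_wpDl.
have [d d0 fgd] := fg x _ (divr_gt0 e0 c1).
exists d => // y z xy yz zx; have := fgd _ _ xy yz zx.
have -> : c * f z - c * f y - c * g x * (z - y) =
  c * (f z - f y - g x * (z - y)) by ring.
rewrite normrM => /(ler_wpM2l (normr_ge0 c)) /le_trans; apply.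
rewrite mulrA ler_wpM2r ?subr_ge0// mulrCA ler_piMr ?(ltW e0)//.
by rewrite ler_pdivrMr// mul1r lerDl.
Qed.

Lemma left_primitiveD f1 g1 f2 g2 : left_primitive f1 g1 -> left_primitive f2 g2 ->
  left_primitive (fun x => f1 x + f2 x) (fun x => g1 x + g2 x).
Proof.
move=> [[L1 fL1] fg1] [[L2 fL2] fg2]; split.
  exists (L1 + L2) => x y; rewrite mulrDl (le_trans _ (lerD (fL1 x y) (fL2 x y)))//.
  by rewrite (le_trans _ (ler_normD _ _))// opprD addrACA.
move=> x e e0; have e20 : 0 < e / 2 by rewrite divr_gt0.
have [d1 d10 fgd1] := fg1 x _ e20; have [d2 d20 fgd2] := fg2 x _ e20.
exists (Num.min d1 d2); first by rewrite lt_min d10.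
move=> y z; rewrite ltrBlDr -ltrBlDl lt_min => /andP[xy1 xy2] yz zx.
have h1 : x - d1 < y by rewrite ltrBlDr -ltrBlDl.
have h2 : x - d2 < y by rewrite ltrBlDr -ltrBlDl.
have -> : e * (z - y) = e / 2 * (z - y) + e / 2 * (z - y) by rewrite -mulrDl -splitr.
apply: le_trans _ (lerD (fgd1 _ _ h1 yz zx) (fgd2 _ _ h2 yz zx)).
rewrite (le_trans _ (ler_normD _ _))// le_eqVlt; apply/orP; left; apply/eqP.
by congr `|_|; ring.
Qed.

Lemma subgradient_left_primitive f g L : subgradient setT f g ->
  left_continuous setT g -> (forall x, `|g x| <= L) -> left_primitive f g.
Proof.
move=> sg cg gL; split.
  have key x y : x <= y -> `|f y - f x| <= L * `|y - x|.
    move=> xy; have := sg x y I I; have := sg y x I I; rewrite /bregman => h1 h2.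
    have := gL x; have := gL y; rewrite !ler_norml => /andP[_ gy] /andP[gx _].
    have yx : 0 <= y - x by rewrite subr_ge0.
    rewrite (ger0_norm yx).
    have := ler_wpM2r yx gy; have := ler_wpM2r yx gx => ? ?.
    by apply/andP; split; lra.
  exists L => x y; have [xy|/ltW yx] := leP x y; first exact: key.
  by rewrite distrC [`|y - x|]distrC key.
move=> x e e0; have [d d0 gd] := cg x I e e0.
exists d => // y z xy yz zx.
have := sg z y I I; have := sg y z I I; rewrite /bregman => h1 h2.
have zy : 0 <= z - y by rewrite subr_ge0.
have := gd z I (lt_le_trans xy yz) zx; have := gd y I xy (le_trans yz zx).
rewrite !ler_distl => /andP[gy _] /andP[_ gz].
have := ler_wpM2r zy gy; have := ler_wpM2r zy gz => ? ?.
by apply/andP; split; lra.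
Qed.

Lemma left_primitive_bounded f g L : left_primitive f g ->
  (forall x y, `|f y - f x| <= L * `|y - x|) -> forall x, `|g x| <= L.
Proof.
move=> [_ fg] fL x; apply/ler_addgt0Pr => e e0.
have [d d0 fgd] := fg x e e0.
have d2 : 0 < d / 2 by rewrite divr_gt0.
have := fgd (x - d / 2) x; rewrite lexx opprB addrCA subrr addr0.
have h1 : x - d < x - d / 2 by lra.
have h2 : x - d / 2 <= x by lra.
move=> /(_ h1 h2 isT); have := fL (x - d / 2) x.
rewrite opprB addrCA subrr addr0 (gtr0_norm d2) => ? ?.
rewrite -(ler_pM2r d2) -[X in `|g x| * X](gtr0_norm d2) -normrM.
rewrite -[g x * _](subKr (f x - f (x - d / 2))) mulrDl.
by rewrite (le_trans (ler_normB _ _))// lerD.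
Qed.

(** The slopes of f just left of y are close to g y by definition, and to g x
    by strictness at x. *)
Lemma left_primitive_left_continuous f g : left_primitive f g ->
  left_continuous setT g.
Proof.
move=> [_ fg] x _ e e0; have [d d0 fgd] := fg x e e0; exists d => // y _ xy yx.
apply/ler_addgt0Pr => r r0; have [d' d'0 fgd'] := fg y r r0.
pose t := Num.min (d' / 2) ((y - (x - d)) / 2).
have t0 : 0 < t by rewrite lt_min !divr_gt0// subr_gt0.
have [t1 t2] : t <= d' / 2 /\ t <= (y - (x - d)) / 2 by split; rewrite ge_min lexx ?orbT.
have h1 : x - d < y - t by lra.
have h2 : y - d' < y - t by lra.
have h3 : y - t <= y by lra.
have := fgd _ _ h1 h3 yx; have := fgd' _ _ h2 h3 (lexx _).
rewrite opprB addrCA subrr addr0 => ? ?.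
rewrite -(ler_pM2r t0) -[X in `|_| * X](gtr0_norm t0) -normrM.
have -> : (g y - g x) * t = (f y - f (y - t) - g x * t) - (f y - f (y - t) - g y * t).
  ring.
by rewrite [leRHS]mulrDl (le_trans (ler_normB _ _))// [leRHS]addrC [leLHS]addrC lerD.
Qed.

Lemma left_primitive_cvg f g x : left_primitive f g ->
  n.+1%:R * (f x - f (x - n.+1%:R^-1)) @[n --> \oo] --> g x.
Proof.
move=> [_ fg]; apply/cvgrPdist_le => e e0; have [d d0 fgd] := fg x e e0.
near=> n.
have n0 : 0 < n.+1%:R^-1 :> R by rewrite invr_gt0.
have h1 : x - d < x - n.+1%:R^-1.
  rewrite ltrD2l ltrN2; near: n; exact: near_infty_natSinv_lt (PosNum d0).
have h2 : x - n.+1%:R^-1 <= x by rewrite gerBl ltW.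
have := fgd _ _ h1 h2 (lexx _).
rewrite opprB addrCA subrr addr0 => h.
rewrite -(ler_pM2r n0) -[X in `|_| * X](gtr0_norm n0) distrC -normrM.
by rewrite mulrBl mulrAC divff ?mul1r// pnatr_eq0.
Unshelve. all: by end_near. Qed.
End left_primitives.

(** * Regularized ramps *)

Section ramps.
Context {R : realType}.
Implicit Types (u s : R -> R).

Definition ramp (m x : R) : R := Num.max (x - m) 0.

Lemma ramp_left_primitive (m : R) : left_primitive (ramp m) (fun x => (m < x)%R%:R).
Proof.
apply: (@subgradient_left_primitive _ _ _ 1).
- move=> x y _ _; rewrite /bregman /ramp.
  case: (ltP m x) => mx; case: (leP (x - m) 0) => ?; case: (leP (y - m) 0) => ? /=; lra.
- move=> x _ e e0; case: (ltP m x) => mx.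
    exists (x - m); first by rewrite subr_gt0.
    by move=> y _; rewrite subKr => -> _; rewrite subrr normr0 ltW.
  exists 1 => // y _ _ yx.
  by rewrite ltNge (le_trans yx mx) subrr normr0 ltW.
- by move=> x; case: (m < x); rewrite ?normr1 ?normr0.
Qed.

Section clamp.
Variables (a b : R).
Definition clamp (x : R) : R := Num.min (Num.max x a) b.

Hypothesis ab : a <= b.

Lemma clampP x : [\/ x < a /\ clamp x = a, (a <= x) /\ (x <= b) /\ clamp x = x | b < x /\ clamp x = b].
Proof.
rewrite /clamp; case: (ltP x a) => xa; first by apply: Or31; rewrite min_l.
by case: (leP x b) => xb; [apply: Or32|apply: Or33].
Qed.
End clamp.

(** With c the clamp to [a, b], the function T x = u (c x) + s (c x) (x - c x)
    continues u by its tangents at a and b, and s \o c is a subgradient of it.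
    V is T minus the tangent at a, normalized to have slope 1 right of b. *)
Lemma exists_ramp (p q : R) u s a b : (let D := `]p, q[%classic in
  subgradient D u s -> left_continuous D s -> D a -> D b -> a < b -> s a < s b ->
  exists m V g, [/\ a <= m <= b, left_primitive V g,
    (exists C, forall x y, D x -> D y -> `|bregman V g x y| <= C * bregman u s x y),
    (forall x, (x <= a) || (b <= x) -> V x = ramp m x) &
    [/\ (forall x, `|V x - ramp m x| <= b - a),
    (forall x, (x <= a) || (b < x) -> g x = (m < x)%R%:R) &
    (forall x, 0 <= g x <= 1)]])%R.
Proof.
move=> D sg cs Da Db ab sab.
have DE x : D x <-> p < x /\ x < q.
  by rewrite /D/= in_itv/=; split=> [/andP[]|[-> ->]].
have ab' := ltW ab.
pose c := clamp a b.
have cP x : [\/ x < a /\ c x = a, a <= x /\ x <= b /\ c x = x | b < x /\ c x = b].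
  exact: clampP.
have Dc x : D (c x).
  case: (cP x) => [[_ ->]|[ax [xb ->]]|[_ ->]] //.
  by apply/DE; move: Da Db => /DE[? ?] /DE[? ?]; split; lra.
have smon x y : D x -> D y -> x <= y -> s x <= s y.
  exact: (subgradient_le sg).
have cab x : a <= c x /\ c x <= b.
  by case: (cP x) => [[_ ->]|[ax [xb ->]]|[_ ->]].
have c1 x y : x <= y -> c x <= c y /\ c y - c x <= y - x.
  move=> xy; case: (cP x) => [[? ->]|[? [? ->]]|[? ->]];
  case: (cP y) => [[? ->]|[? [? ->]]|[? ->]]; split; lra.
have sc x : s a <= s (c x) /\ s (c x) <= s b.
  by have [? ?] := cab x; split; exact: smon.
pose T x := u (c x) + s (c x) * (x - c x).
(* The divergence of T is that of u between the clamped points, plus a term that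
   is nonzero only if y lies outside [a, b], and then has the right sign since
   s \o c lies between s a and s b. *)
have T0 x y : 0 <= bregman T (s \o c) x y.
  have -> : bregman T (s \o c) x y =
      bregman u s (c x) (c y) + (s (c y) - s (c x)) * (y - c y).
    by rewrite /bregman /T /=; ring.
  rewrite addr_ge0//; first exact: sg.
  have [? ?] := sc x.
  case: (cP y) => [[? ->]|[? [? ->]]|[? ->]].
  - by rewrite mulr_le0 ?subr_le0// ltW.
  - by rewrite subrr mulr0.
  - by rewrite mulr_ge0 ?subr_ge0// ltW.
have Tu x y : D x -> D y -> bregman T (s \o c) x y <= bregman u s x y.
  move=> Dx Dy; rewrite -subr_ge0.
  have E : bregman u s x y - bregman T (s \o c) x y =
      bregman u s x (c x) + bregman u s (c y) y + (s (c x) - s x) * (y - c x).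
    by rewrite /bregman /T /=; ring.
  (* When x and y lie beyond the same end, T is affine between them. *)
  have E0 : c x = c y -> 0 <= bregman u s x y - bregman T (s \o c) x y.
    move=> xy; rewrite [bregman T _ _ _](_ : _ = 0) ?subr0 ?sg//.
    by rewrite /bregman /T /= xy; ring.
  have h0 : 0 <= bregman u s x (c x) + bregman u s (c y) y by rewrite addr_ge0// sg.
  have [xa|[_ [_ cx]]|xb] := cP x; last 2 first.
  - by rewrite E addr_ge0// cx subrr mul0r.
  - have [yb|by_] := leP y b; last first.
      by apply: E0; rewrite [LHS]xb.2; case: (cP y) => [[? _]|[? [? _]]|[_ ->]//]; lra.
    rewrite E addr_ge0// xb.2 mulr_le0// subr_le0//.
    by apply: smon => //; exact: ltW xb.1.
  - have [ya|ay] := ltP y a.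
      by apply: E0; rewrite [LHS]xa.2; case: (cP y) => [[_ ->]//|[? [? _]]|[? _]]; lra.
    rewrite E addr_ge0// xa.2 mulr_ge0// subr_ge0//.
    by apply: smon => //; exact: ltW xa.1.
pose Z := s b - s a; have Z0 : 0 < Z by rewrite subr_gt0.
pose k := Z^-1; have k0 : 0 < k by rewrite invr_gt0.
have kZ : Z * k = 1 by rewrite divff// gt_eqF.
pose V x := k * (T x - u a - s a * (x - a)).
pose g x := k * (s (c x) - s a).
(* m is where the tangents to u at a and at b meet. *)
pose m := b - k * bregman u s a b.
have Vg x y : bregman V g x y = k * bregman T (s \o c) x y.
  by rewrite /bregman /V /g /=; ring.
have g01 x : 0 <= g x <= 1.
  have [? ?] := sc x; apply/andP; split; first by rewrite mulr_ge0 ?(ltW k0) ?subr_ge0.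
  by rewrite /g -kZ mulrC ler_pM2r// lerD2r.
have ma : a <= m.
  rewrite /m lerBrDr -lerBrDl -[leRHS]mul1r -kZ [Z * k]mulrC -[leRHS]mulrA ler_pM2l//.
  have := sg _ _ Db Da; rewrite /bregman /Z => h.
  by rewrite -subr_ge0; apply: le_trans h _; rewrite le_eqVlt; apply/orP; left; apply/eqP; ring.
have mb : m <= b by rewrite gerBl mulr_ge0 ?sg// ltW.
have Va x : x <= a -> c x = a /\ V x = 0.
  move=> xa; have cx : c x = a.
    by case: (cP x) => [[_ ->]//|[? [? ->]]|[? ->]]; lra.
  by split=> //; rewrite /V /T cx; ring.
have Vb x : b <= x -> c x = b /\ V x = x - m.
  move=> xb; have cx : c x = b.
    by case: (cP x) => [[? ->]|[? [? ->]]|[? ->]]; lra.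
  split=> //; apply/eqP; rewrite -subr_eq0 [X in X == 0](_ : _ = (Z * k - 1) * (x - b)).
    by rewrite kZ subrr mul0r.
  by rewrite /V /T cx /m /Z /bregman; ring.
exists m, V, g; split.
- by rewrite ma mb.
- apply: (@subgradient_left_primitive _ _ _ 1).
  + by move=> x y _ _; rewrite Vg mulr_ge0// ltW.
  + move=> x _ e e0; have [d d0 sd] := cs (c x) (Dc x) (e / k) (divr_gt0 e0 k0).
    exists d => // y _ xy yx; have [? ?] := c1 _ _ yx.
    rewrite /g -mulrBr opprB addrA subrK normrM gtr0_norm// mulrC -ler_pdivlMr//.
    by apply: sd => //; lra.
  + by move=> x; have /andP[? ?] := g01 x; rewrite ger0_norm.
- exists k => x y Dx Dy; rewrite Vg ger0_norm ?mulr_ge0 ?(ltW k0)//.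
  by rewrite ler_pM2l// Tu.
- move=> x /orP[xa|xb].
    by rewrite (Va _ xa).2 /ramp max_r// subr_le0 (le_trans xa).
  by rewrite (Vb _ xb).2 /ramp max_l// subr_ge0 (le_trans mb).
split=> //.
- move=> x; have [xa|ax] := leP x a.
    by rewrite (Va _ xa).2 /ramp max_r ?subrr ?normr0 ?subr_ge0// subr_le0 (le_trans xa).
  have [xb|/ltW bx] := leP x b; last first.
    by rewrite (Vb _ bx).2 /ramp max_l ?subrr ?normr0 ?subr_ge0// (le_trans mb).
  have := Vg x a; have := Vg a x; have := T0 x a; have := T0 a x.
  move=> /(mulr_ge0 (ltW k0)) h1 /(mulr_ge0 (ltW k0)) h2 h3 h4.
  rewrite -h3 /bregman in h1; rewrite -h4 /bregman in h2.
  rewrite (Va _ (lexx a)).2 {h3 h4} in h1 h2.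
  rewrite [g a](_ : _ = 0) in h1; last by rewrite /g (Va _ (lexx a)).1 subrr mulr0.
  have /andP[g0 g1] := g01 x.
  have xa : 0 <= x - a by rewrite subr_ge0 ltW.
  have := ler_wpM2r xa g1 => g2.
  rewrite /ramp; case: (leP (x - m) 0) => ?; rewrite ler_norml; apply/andP; split; lra.
- move=> x /orP[xa|xb].
    rewrite /g (Va _ xa).1 subrr mulr0; case: ltP => // mx.
    by have := lt_le_trans mx (le_trans xa ma); rewrite ltxx.
  rewrite /g (Vb _ (ltW xb)).1 mulrC kZ; case: ltP => // xm.
  by have := lt_le_trans xb (le_trans xm mb); rewrite ltxx.
Qed.
End ramps.

(** * Smooth functions and test functions *)

Section smooth.
Context {R : realType}.
Implicit Types (f g psi : R -> R).

Definition smooth f : Prop := forall n x, derivable (derive1n n f) x 1.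

(** Membership in a class of differentiable functions that is stable under
    derivation: this replaces explicit formulas for iterated derivatives. *)
Lemma smooth_coind (P : (R -> R) -> Prop) :
  (forall f, P f -> (forall x, derivable f x 1) /\ P (derive1 f)) ->
  forall f, P f -> smooth f.
Proof.
move=> PP f Pf n; have [] // := PP (derive1n n f).
by elim: n => [//|n /PP[_]].
Qed.

Lemma smooth_derivable f : smooth f -> forall x, derivable f x 1.
Proof. by move/(_ 0%N). Qed.

Lemma smooth_derive1 f : smooth f -> smooth (derive1 f).
Proof. by move=> sf n x; have := sf n.+1 x; rewrite derive1Sn. Qed.

Lemma smooth_is_derive f : smooth f -> forall x : R, is_derive x (1 : R) f ((derive1 f) x).
Proof.
by move=> sf x; rewrite derive1E; apply: DeriveDef => //; exact: smooth_derivable.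
Qed.

Lemma smooth_continuous f : smooth f -> continuous f.
Proof.
by move=> sf x; apply/differentiable_continuous/derivable1_diffP/smooth_derivable.
Qed.

(** The smallest class that contains the products of smooth functions and is
    stable under derivation, by the Leibniz rule. *)
Inductive sum_of_products : (R -> R) -> Prop :=
| Sop_mul f g : smooth f -> smooth g -> sum_of_products (f * g)
| Sop_add f g : sum_of_products f -> sum_of_products g -> sum_of_products (f + g).

Lemma smoothM f g : smooth f -> smooth g -> smooth (f * g).
Proof.
move=> sf sg; apply: (smooth_coind _ (Sop_mul sf sg)).
clear; move=> h; elim=> [f g sf sg|f1 g1 _ [df pf] _ [dg pg]]; split.
- by move=> x; apply: derivableM; exact: smooth_derivable.
- rewrite (_ : derive1 _ = f * (derive1 g) + g * (derive1 f)).
    by apply: Sop_add; apply: Sop_mul => //; exact: smooth_derive1.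
  apply/funext => x; rewrite derive1E deriveM; [by rewrite -!derive1E|exact: smooth_derivable..].
- by move=> x; apply: derivableD.
- rewrite (_ : derive1 _ = (derive1 f1) + (derive1 g1)); first exact: Sop_add.
  by apply/funext => x; rewrite derive1E deriveD// -!derive1E.
Qed.

Lemma smooth_affine (a b : R) : smooth (fun x => a * x + b).
Proof.
pose P f := exists a b : R, f = (fun x => a * x + b).
apply: (smooth_coind (P := P)); last by exists a, b.
move=> _ [{}a [{}b ->]].
have D x : is_derive x (1 : R) (fun x => a * x + b) a.
  by apply: is_derive_eq; rewrite addr0 /GRing.scale/= mulr1.
split=> [x|]; first by have [] := D x.
exists 0, a; apply/funext => x; rewrite mul0r add0r derive1E.
by have [] := D x.
Qed.

Lemma smooth_shift f (c : R) : smooth f -> smooth (fun x => f (x + c)).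
Proof.
pose P g := exists2 f, smooth f & g = (fun x => f (x + c)).
move=> sf; apply: (smooth_coind (P := P)); last by exists f.
move=> _ [{sf}f sf ->].
have D x : is_derive x (1 : R) (fun x => f (x + c)) ((derive1 f) (x + c)).
  have sh : is_derive x (1 : R) (fun x => x + c) 1.
    by apply: is_derive_eq; rewrite ?addr0.
  have := @is_derive1_comp _ f (fun x => x + c) x _ _ (smooth_is_derive sf _) sh.
  by rewrite mulr1.
split=> [x|]; first by have [] := D x.
exists (derive1 f); first exact: smooth_derive1.
by apply/funext => x; rewrite derive1E; have [] := D x.
Qed.

End smooth.

Section test_functions.
Context {R : realType}.
Implicit Types (f g psi : R -> R) (D : set R).

Definition supported (a b : R) f : Prop := forall x, f x != 0 -> a <= x <= b.

Lemma supported0 a b f x : supported a b f -> ~ (a <= x <= b) -> f x = 0.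
Proof. by move=> fab nx; apply/eqP; apply: contra_notT nx; exact: fab. Qed.

Lemma compactly_supported_segment D f : compactly_supported D f ->
  exists2 M, 0 < M & supported (- M) M f.
Proof.
move=> [/compact_bounded[M [_ fM]] _].
exists (Num.max M 0 + 1); first by rewrite ltr_wpDl// le_max lexx orbT.
move=> x fx; rewrite -ler_norml; apply: fM.
  by rewrite ltr_pwDr// le_max lexx.
exact: subset_closure.
Qed.

Lemma segment_compactly_supported D f a b : supported a b f ->
  `[a, b]%classic `<=` D -> compactly_supported D f.
Proof.
move=> fab abD; have cl : closure [set x | f x != 0] `<=` `[a, b]%classic.
  rewrite [X in _ `<=` X](closure_id _).1; last exact: itv_closed.
  by apply: closureS => x /fab; rewrite /= in_itv.
split; last exact: subset_trans cl abD.
exact: subclosed_compact (@closed_closure _ _) (@segment_compact _ a b) cl.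
Qed.

Lemma compactly_supportedW D f g : compactly_supported D f ->
  (forall x, g x != 0 -> closure [set x | f x != 0] x) -> compactly_supported D g.
Proof.
move=> [cf fD] gf; have cl : closure [set x | g x != 0] `<=` closure [set x | f x != 0].
  by rewrite [X in _ `<=` X](closure_id _).1; [exact: closureS|exact: closed_closure].
split; last exact: subset_trans cl fD.
exact: subclosed_compact (@closed_closure _ _) cf cl.
Qed.

Lemma test_function_derive1 D psi : test_function D psi -> test_function D (derive1 psi).
Proof.
move=> [sp cp]; split; first exact: smooth_derive1.
apply: compactly_supportedW cp _ => x; apply: contraPP => nx; apply/negP; rewrite negbK.
have : nbhs x (~` [set x | psi x != 0]).
  by change ((~` [set x | psi x != 0])° x); rewrite interiorC.
move=> n0; rewrite derive1E; apply/eqP.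
rewrite (@near_eq_derive _ _ _ psi (cst 0) x 1) ?derive_cst//.
by apply: filterS n0 => y /= /negP; rewrite negbK => /eqP.
Qed.

Lemma test_function_setT D psi : test_function D psi -> test_function setT psi.
Proof. by move=> [sp [cp _]]; split=> //; split. Qed.

Lemma test_functionM D f psi : smooth f -> test_function D psi -> test_function D (f * psi).
Proof.
move=> sf [sp cp]; split; first exact: smoothM.
apply: compactly_supportedW cp _ => x fx; apply: subset_closure => /=.
by apply: contra_neq fx => /= px; rewrite [LHS]/= /GRing.mul /= px mulr0.
Qed.

Lemma test_function_shift psi c : test_function setT psi ->
  test_function setT (fun x => psi (x + c)).
Proof.
move=> [sp /compactly_supported_segment[M _ pM]]; split; first exact: smooth_shift.
apply: (@segment_compactly_supported _ _ (- M - c) (M - c)) => // x /pM.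
by rewrite lerBlDr lerBrDr.
Qed.

Lemma test_function_bounded D psi : test_function D psi -> exists C, forall x, `|psi x| <= C.
Proof.
move=> [sp /compactly_supported_segment[M M0 pM]].
have cp : {within `[- M, M], continuous psi}.
  by apply: continuous_subspaceT; exact: smooth_continuous.
have /compact_bounded[C [_ pC]] := continuous_compact cp (@segment_compact _ _ _).
exists (Num.max (C + 1) 0) => x; have [xM|xM] := boolP (- M <= x <= M).
  rewrite le_max; apply/orP; left; apply: pC; first by rewrite ltrDl.
  by exists x => //=; rewrite in_itv.
by rewrite (supported0 pM) ?normr0 ?le_max ?lexx ?orbT//; exact/negP.
Qed.

Lemma test_function_left_primitive D psi : test_function D psi ->
  left_primitive psi (derive1 psi).
Proof.
move=> tp; have [sp _] := tp.
have mvt x y : x <= y -> exists2 c, x <= c <= y & psi y - psi x = derive1 psi c * (y - x).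
  move=> xy; have [|| c] := @MVT_segment _ psi (derive1 psi) x y xy.
  - by move=> z _; exact: smooth_is_derive.
  - by apply: continuous_subspaceT; exact: smooth_continuous.
  by rewrite in_itv/= => cxy ->; exists c.
have [C pC] := test_function_bounded (test_function_derive1 tp).
split.
  have key x y : x <= y -> `|psi y - psi x| <= C * `|y - x|.
    by move=> /mvt[c _ ->]; rewrite normrM ler_wpM2r.
  exists C => x y; have [xy|/ltW yx] := leP x y; first exact: key.
  by rewrite distrC [`|y - x|]distrC key.
have cp : continuous (derive1 psi) by apply: smooth_continuous; exact: smooth_derive1.
move=> x e e0; have /cvgrPdist_le/(_ _ e0)/nbhs_ballP[d /= d0 pd] := cp x.
exists d => // y z xy yz zx; have [c /andP[yc cz] ->] := mvt _ _ yz.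
rewrite -mulrBl normrM [`|z - y|]ger0_norm ?subr_ge0//.
rewrite ler_wpM2r ?subr_ge0// distrC; apply: pd.
by rewrite /ball/= ger0_norm; lra.
Qed.
End test_functions.

(** * Translation invariance of the Lebesgue integral *)

Section integration.
Context {R : realType}.
Notation mu := (@lebesgue_measure R).
Implicit Types (f g psi : R -> R) (D : set R).

Lemma supported_integrable D f a b C : measurable D -> measurable_fun setT f ->
  (forall x, `|f x| <= C) -> supported a b f -> mu.-integrable D (EFin \o f).
Proof.
move=> mD mf fC fab.
have ii : mu.-integrable setT (EFin \o (fun x => C * \1_`[a, b]%classic x)).
  by have := integrableZl measurableT C (integrable_indic_itv a b true false).
apply: (@integrableS _ _ _ mu setT D) => //.
apply: le_integrable ii => //; first exact/measurable_EFinP.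
move=> x _ /=; rewrite lee_fin indicE; have C0 := le_trans (normr_ge0 _) (fC x).
have [xab|xab] := boolP (a <= x <= b).
  by rewrite mem_set ?mulr1 ?(ger0_norm C0)//= in_itv.
by rewrite (supported0 fab) ?normr0//; exact/negP.
Qed.

Lemma lebesgue_measure_shift (c : R) (A : set R) : measurable A ->
  mu ((fun x => x + c) @^-1` A) = mu A.
Proof.
have mc : measurable_fun setT (fun x : measurableTypeR R => x + c : measurableTypeR R).
  by apply: measurable_funD.
pose f : {mfun _ >-> _} := HB.pack (fun x : measurableTypeR R => x + c : measurableTypeR R)
   (isMeasurableFun.Build _ _ _ _ _ mc).
move=> mA; rewrite [RHS](@lebesgue_measure_unique _ (pushforward mu f))//.
move=> _ [[a b] _ <-] /=; rewrite /pushforward lebesgue_measure_itv /=.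
rewrite (_ : _ @^-1` _ = `]a - c, b - c]%classic); last first.
  by apply/seteqP; split=> x /=; rewrite !in_itv/= ltrBlDr lerBrDr.
rewrite lebesgue_measure_itv/= !lte_fin ltrD2r; case: ifP => // _.
by rewrite -!EFinB; congr EFin; ring.
Qed.

Lemma Rintegral_shift f (c : R) : mu.-integrable setT (EFin \o f) ->
  mu.-integrable setT (EFin \o (fun x => f (x + c))) /\
  \int[mu]_x f (x + c) = \int[mu]_x f x.
Proof.
move=> intf.
have mc : measurable_fun setT (fun x : measurableTypeR R => x + c : measurableTypeR R).
  by apply: measurable_funD.
pose h : {mfun _ >-> _} := HB.pack (fun x : measurableTypeR R => x + c : measurableTypeR R)
   (isMeasurableFun.Build _ _ _ _ _ mc).
have muE (F : R -> \bar R) : (\int[mu]_x F x = \int[pushforward mu h]_x F x)%E.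
  by apply: eq_measure_integral => A mA _; apply/esym; exact: lebesgue_measure_shift.
have [mf foo] := integrableP _ _ _ intf.
have {}mf : measurable_fun setT f by exact/measurable_EFinP.
have mfc : measurable_fun setT (fun x : R => f (x + c)) by exact: (measurableT_comp mf mc).
have intfc : mu.-integrable setT (EFin \o (fun x => f (x + c))).
  apply/integrableP; split; first exact/measurable_EFinP.
  move: foo; rewrite muE ge0_integral_pushforward//.
  by do 2 apply: measurableT_comp => //.
split=> //; rewrite /Rintegral [in RHS]muE integral_pushforward//.
exact/measurable_EFinP.
Qed.
End integration.

(** * Weak derivatives of left primitives *)

Section weak_derivatives.
Context {R : realType}.
Notation mu := (@lebesgue_measure R).
Implicit Types (f g psi : R -> R) (D : set R).

Lemma lipschitz_continuous f L : (forall x y, `|f y - f x| <= L * `|y - x|) ->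
  continuous f.
Proof.
move=> fL x; apply/cvgrPdist_le => e e0.
have L0 : 0 < `|L| + 1 by rewrite ltr_wpDl.
apply/nbhs_ballP; exists (e / (`|L| + 1)); first by rewrite /= divr_gt0.
move=> y /=; rewrite /ball/= distrC => /ltW; rewrite ler_pdivlMr// => yx.
rewrite distrC (le_trans (fL _ _))// (le_trans _ yx)// mulrC ler_wpM2l//.
by rewrite (le_trans (ler_norm _))// lerDl.
Qed.

Lemma left_primitive_continuous f g : left_primitive f g -> continuous f.
Proof. by move=> [[L fL] _]; exact: lipschitz_continuous fL. Qed.

Lemma left_primitive_measurable f g : left_primitive f g -> measurable_fun setT f.
Proof. by move/left_primitive_continuous/continuous_measurable_fun. Qed.

Lemma measurable_comp_subr f (c : R) : measurable_fun setT f ->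
  measurable_fun setT (fun x : R => f (x - c)).
Proof. by move=> mf; apply: (measurableT_comp mf); exact: measurable_funB. Qed.

Lemma left_primitive_measurable_derivative f g : left_primitive f g ->
  measurable_fun setT g.
Proof.
move=> fg; have mf := left_primitive_measurable fg.
apply: (@measurable_fun_cvg _ _ _ _ (fun n (x : R) => n.+1%:R * (f x - f (x - n.+1%:R^-1)))).
  move=> n; apply: measurable_funM => //; apply: measurable_funB => //.
  exact: measurable_comp_subr.
by move=> x _; exact: left_primitive_cvg.
Qed.

Lemma supported_lipschitz_bounded f a b L : (forall x y, `|f y - f x| <= L * `|y - x|) ->
  supported a b f -> exists C, forall x, `|f x| <= C.
Proof.
move=> fL fab; exists (`|L| * (`|b| + `|a| + 1)) => x.
have [xab|xab] := boolP (a <= x <= b); last first.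
  by rewrite (supported0 fab) ?normr0 ?mulr_ge0 ?addr_ge0//; exact/negP.
have fa : f (a - 1) = 0 by apply: (supported0 fab) => /andP[+ _]; lra.
have := fL (a - 1) x; rewrite fa subr0 => /le_trans; apply.
rewrite (le_trans (ler_wpM2r _ (ler_norm L)))// ler_wpM2l//.
move/andP : xab => [ax xb]; rewrite ger0_norm; last lra.
by have := ler_norm b; have := ler_norm (- a); rewrite normrN; lra.
Qed.

Lemma dominated_Rintegral_cvg D (f_ : nat -> R -> R) f g : measurable D ->
  (forall n, measurable_fun D (f_ n)) -> measurable_fun D f ->
  (forall x, D x -> f_ n x @[n --> \oo] --> f x) ->
  mu.-integrable D (EFin \o g) -> (forall n x, D x -> `|f_ n x| <= g x) ->
  \int[mu]_(x in D) f_ n x @[n --> \oo] --> \int[mu]_(x in D) f x.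
Proof.
move=> mD mf_ mf cf ig fg.
have [| | | | | intf _ h] := @dominated_convergence _ _ _ mu D mD
    (fun n => EFin \o f_ n) (EFin \o f) (EFin \o g) => //.
- by move=> n; apply/measurable_EFinP; exact: mf_.
- exact/measurable_EFinP.
- by apply: aeW => x Dx; apply: cvg_EFin; [exact: nearW|exact: cf].
- by apply: aeW => x n Dx; rewrite /= lee_fin fg.
apply: fine_cvg; rewrite fineK//.
exact: integrable_fin_num.
Qed.

(** The difference quotients of f have integral 0 by translation invariance; they
    are bounded by L and converge to p. *)
Lemma Rintegral_left_derivative f p L a b : (forall x y, `|f y - f x| <= L * `|y - x|) ->
  supported a b f ->
  (forall x, n.+1%:R * (f x - f (x - n.+1%:R^-1)) @[n --> \oo] --> p x) ->
  \int[mu]_x p x = 0.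
Proof.
move=> fL fab fp; have [C fC] := supported_lipschitz_bounded fL fab.
have mf : measurable_fun setT f.
  by apply: continuous_measurable_fun; exact: lipschitz_continuous fL.
pose f_ n x : R := n.+1%:R * (f x - f (x - n.+1%:R^-1)).
have mf_ n : measurable_fun setT (f_ n).
  apply: measurable_funM => //; apply: measurable_funB => //.
  exact: measurable_comp_subr.
have mp : measurable_fun setT p by apply: (measurable_fun_cvg mf_) => x _; exact: fp.
have intf : mu.-integrable setT (EFin \o f) by exact: supported_integrable fC fab.
have f_0 n : \int[mu]_x f_ n x = 0.
  have [intfn efn] := Rintegral_shift (- n.+1%:R^-1) intf.
  rewrite RintegralZl//; last by have := integrableB measurableT intf intfn.
  by rewrite RintegralB// efn subrr mulr0.
have : \int[mu]_x f_ n x @[n --> \oo] --> \int[mu]_x p x.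
  apply: (dominated_Rintegral_cvg (g := fun x => L * \1_`[a, b + 1]%classic x)) => //.
  - by move=> x _; exact: fp.
  - by have := integrableZl measurableT L (integrable_indic_itv a (b + 1) true false).
  - move=> n x _; rewrite /f_ indicE.
    have n0 : 0 < n.+1%:R^-1 :> R by rewrite invr_gt0.
    have n1 : n.+1%:R^-1 <= 1 :> R by rewrite invf_le1// ler1n.
    have L0 : 0 <= L.
      by have := fL 0 1; rewrite subr0 normr1 mulr1; exact: le_trans.
    have [xab|xab] := boolP (a <= x <= b + 1).
      rewrite mem_set ?mulr1 /= ?in_itv// normrM.
      have := fL (x - n.+1%:R^-1) x; rewrite opprB addrCA subrr addr0 => /(ler_wpM2l (normr_ge0 (n.+1%:R : R))).
      move/le_trans; apply; rewrite mulrCA gtr0_norm// gtr0_norm//.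
      by rewrite divff ?mulr1// pnatr_eq0.
    move: n0 n1; set t := n.+1%:R^-1 => n0 n1.
    rewrite (supported0 fab) ?(supported0 fab) ?subrr ?mulr0 ?normr0 ?mulr_ge0//.
      by move=> /andP[? ?]; move/negP : xab; apply; apply/andP; split; lra.
    by move=> /andP[? ?]; move/negP : xab; apply; apply/andP; split; lra.
under eq_cvg do rewrite f_0.
by move=> /cvg_lim <-//; rewrite lim_cst.
Qed.

(** The product f * psi is Lipschitz with compact support, and its left derivative
    f psi' + g psi therefore has integral 0. *)
Lemma left_primitive_by_parts f g psi : left_primitive f g ->
  (exists C, forall x, `|f x| <= C) -> test_function setT psi ->
  \int[mu]_x (f x * derive1 psi x) = - \int[mu]_x (g x * psi x).
Proof.
move=> fg [C fC] tpsi; have [[L fL] _] := fg.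
have pg := test_function_left_primitive tpsi; have [[M psiM] _] := pg.
have tpsi' := test_function_derive1 tpsi.
have [B psiB] := test_function_bounded tpsi.
have [B' psiB'] := test_function_bounded tpsi'.
have [r _ psir] := compactly_supported_segment tpsi.2.
have [r' _ psir'] := compactly_supported_segment tpsi'.2.
have gL := left_primitive_bounded fg fL.
have mf := left_primitive_measurable fg.
have mg := left_primitive_measurable_derivative fg.
have mpsi := left_primitive_measurable pg.
have mpsi' := left_primitive_measurable_derivative pg.
have int1 : mu.-integrable setT (EFin \o (fun x => f x * derive1 psi x)).
  apply: (@supported_integrable _ _ _ (- r') r' (C * B')) => //.
  - exact: measurable_funM.
  - by move=> x; rewrite normrM ler_pM.
  - by move=> x; rewrite mulf_eq0 negb_or => /andP[_ /psir'].
have int2 : mu.-integrable setT (EFin \o (fun x => g x * psi x)).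
  apply: (@supported_integrable _ _ _ (- r) r (L * B)) => //.
  - exact: measurable_funM.
  - by move=> x; rewrite normrM ler_pM.
  - by move=> x; rewrite mulf_eq0 negb_or => /andP[_ /psir].
apply/eqP; rewrite -subr_eq0 opprK -RintegralD//; apply/eqP.
apply: (@Rintegral_left_derivative (fun x => f x * psi x) _ (C * M + L * B) (- r) r).
- move=> x y.
  have -> : f y * psi y - f x * psi x = f y * (psi y - psi x) + (f y - f x) * psi x by ring.
  rewrite (le_trans (ler_normD _ _))// [leRHS]mulrDl lerD// normrM.
    by rewrite -mulrA ler_pM.
  by rewrite mulrAC ler_pM.
- by move=> x; rewrite mulf_eq0 negb_or => /andP[_ /psir].
- move=> x.
  rewrite (_ : (fun n => _) = (fun n => f x * (n.+1%:R * (psi x - psi (x - n.+1%:R^-1))) +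
    n.+1%:R * (f x - f (x - n.+1%:R^-1)) * psi (x - n.+1%:R^-1))); last first.
    by apply/funext => n; ring.
  apply: cvgD; first by apply: cvgMr; exact: left_primitive_cvg.
  apply: cvgM; first exact: left_primitive_cvg.
  have cpsi := left_primitive_continuous pg.
  have xn : x - n.+1%:R^-1 @[n --> \oo] --> x.
    rewrite -[X in _ --> X]subr0; apply: cvgB; first exact: cvg_cst.
    exact: cvg_harmonic.
  exact: (cvg_comp _ _ xn (cpsi x)).
Qed.

Lemma regular_distributionE D f psi : measurable D -> (forall x, psi x != 0 -> D x) ->
  regular_distribution D f psi = \int[mu]_x (f x * psi x).
Proof.
move=> mD pD; rewrite /regular_distribution Rintegral_mkcond; apply: eq_Rintegral => x _.
rewrite patchE; case: ifPn => // /negP nDx.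
rewrite (_ : psi x = 0) ?mulr0//; apply/eqP; apply: contra_notT nDx => /pD.
exact: mem_set.
Qed.

Lemma test_function_subset D psi x : test_function D psi -> psi x != 0 -> D x.
Proof. by move=> [_ [_ pD]] px; apply: pD; exact: subset_closure. Qed.

Lemma bounded_locally_integrable D f C : open D -> (mu D < +oo)%E ->
  measurable_fun setT f -> (forall x, `|f x| <= C) -> locally_integrable D f.
Proof.
move=> oD Dfin mf fC; apply: open_integrable_locally => //.
have mD : measurable D by exact: open_measurable.
apply: measurable_bounded_integrable => //; first exact: measurable_funTS.
by exists C; split; [exact: num_real|move=> M CM x _; exact: le_trans (fC x) (ltW CM)].
Qed.

Lemma left_primitive_weak_derivative D f g : open D -> (mu D < +oo)%E ->
  left_primitive f g -> (exists C, forall x, `|f x| <= C) -> weak_derivative D f g.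
Proof.
move=> oD Dfin fg [C fC]; have [[L fL] _] := fg.
have mD : measurable D by exact: open_measurable.
split.
- apply: bounded_locally_integrable fC => //; exact: left_primitive_measurable fg.
- apply: (bounded_locally_integrable _ _ _ (left_primitive_bounded fg fL)) => //.
  exact: left_primitive_measurable_derivative fg.
- move=> psi tpsi; rewrite /distributional_derivative.
  rewrite !regular_distributionE//.
  + rewrite (left_primitive_by_parts fg) ?opprK//; first by exists C.
    exact: test_function_setT tpsi.
  + by move=> x; exact: test_function_subset.
  + by move=> x; apply: test_function_subset; exact: test_function_derive1.
Qed.
End weak_derivatives.

(** * Bounded convergence in Lp *)

Section Lp_convergence.
Context {R : realType}.
Notation mu := (@lebesgue_measure R).
Implicit Types (f g psi : R -> R) (D : set R).

Lemma powR_cvg0 (r : R) (u_ : nat -> R) : 0 < r -> (forall n, 0 <= u_ n) ->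
  u_ n @[n --> \oo] --> 0 -> u_ n `^ r @[n --> \oo] --> 0.
Proof.
move=> r0 u0 cu; apply/cvgr0Pnorm_le => e e0.
have er : 0 < e `^ r^-1 by exact: powR_gt0.
move/cvgr0Pnorm_le : cu => /(_ _ er); apply: filterS => n; rewrite !ger0_norm ?powR_ge0//.
move=> ue; rewrite -[leRHS]powRr1 ?(ltW e0)// -(@mulVf _ r) ?gt_eqF// powRrM.
by apply: (ge0_ler_powR (ltW r0)); rewrite // nnegrE ?powR_ge0.
Qed.

Lemma Lnorm_restrict D f (r : R) : measurable D -> 0 < r ->
  ('N[mu]_r%:E[EFin \o (f \_ D)] = (\int[mu]_(x in D) (`|f x| `^ r)%:E) `^ r^-1)%E.
Proof.
move=> mD r0; rewrite unlock; congr poweR; rewrite [RHS]integral_mkcond.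
apply: eq_integral => x _ /=; rewrite !patchE; case: ifPn => // _.
by rewrite normr0 powR0// gt_eqF.
Qed.

Variables (D : set R) (mD : measurable D) (Dfin : (mu D < +oo)%E).
Variables (r : R) (r0 : 0 < r).

Lemma bounded_Lp f C : measurable_fun setT f -> (forall x, `|f x| <= C) -> Lp D r%:E f.
Proof.
move=> mf fC; apply/andP; split; rewrite inE/=.
  by apply/(measurable_restrictT _ mD); exact: measurable_funTS.
rewrite /finite_norm Lnorm_restrict// poweR_lty//.
apply: (@le_lt_trans _ _ (\int[mu]_(x in D) (C `^ r)%:E)%E).
  apply: ge0_le_integral => //.
  - apply/measurable_EFinP; apply: (measurableT_comp (measurable_powR _)).
    by apply: measurableT_comp => //; exact: measurable_funTS.
  - move=> x _; rewrite lee_fin; apply: (ge0_ler_powR (ltW r0)) => //.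
    by rewrite nnegrE (le_trans (normr_ge0 _) (fC x)).
by rewrite integral_cst//= lte_mul_pinfty// lee_fin powR_ge0.
Qed.

Lemma bounded_Lp_cvg (f_ : nat -> R -> R) f C :
  (forall k, measurable_fun setT (f_ k)) -> measurable_fun setT f ->
  (forall k x, `|f_ k x| <= C) -> (forall x, `|f x| <= C) ->
  {ae mu, forall x, D x -> f_ k x @[k --> \oo] --> f x} ->
  Lp_cvg D r%:E f_ f.
Proof.
move=> mf_ mf f_C fC f_f; split.
- by move=> k; exact: bounded_Lp.
- exact: bounded_Lp.
pose J k := (\int[mu]_(x in D) (`|f_ k x - f x| `^ r)%:E)%E.
have C0 : 0 <= C by exact: le_trans (normr_ge0 _) (fC 0).
have mJ k : measurable_fun D (fun x => (`|f_ k x - f x| `^ r)).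
  apply: (measurableT_comp (measurable_powR _)).
  by apply: measurableT_comp => //; apply: measurable_funB; exact: measurable_funTS.
have cint : mu.-integrable D (EFin \o cst ((C + C) `^ r)).
  by apply: measurable_bounded_integrable => //; exact: bounded_cst.
have JC k x : `|f_ k x - f x| `^ r <= (C + C) `^ r.
  apply: (ge0_ler_powR (ltW r0)); rewrite ?nnegrE ?addr_ge0//.
  by rewrite (le_trans (ler_normB _ _))// lerD.
have [| | | | | intf _ Jcvg] := @dominated_convergence _ _ _ mu D mD
    (fun k x => (`|f_ k x - f x| `^ r)%:E) (cst 0%E) (EFin \o cst ((C + C) `^ r)) => //.
- by move=> k; apply/measurable_EFinP; exact: mJ.
- move: f_f; apply: (@filterS _ _ (ae_filter_ringOfSetsType mu)) => x f_f Dx; apply: cvg_EFin; first exact: nearW.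
  apply: powR_cvg0 => //; rewrite -(normr0 R); apply: cvg_norm.
  by apply/subr_cvg0; exact: f_f.
- by apply: aeW => x k Dx; rewrite /= lee_fin ger0_norm ?powR_ge0.
have {}Jcvg : J k @[k --> \oo] --> 0%E by rewrite integral0 in Jcvg.
have JE k : J k = (fine (J k))%:E.
  rewrite fineK//; apply: integrable_fin_num => //.
  apply: le_integrable cint => //; first by apply/measurable_EFinP; exact: mJ.
  by move=> x Dx /=; rewrite lee_fin [leLHS]ger0_norm ?powR_ge0// [leRHS]ger0_norm ?powR_ge0.
have J0 k : 0 <= fine (J k).
  by rewrite fine_ge0//; apply: integral_ge0 => x _; rewrite lee_fin powR_ge0.
rewrite (_ : (fun k => _) = (fun k => (fine (J k) `^ r^-1)%:E)); last first.
  by apply/funext => k; rewrite Lnorm_restrict//= -/(J k) JE.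
apply: cvg_EFin; first exact: nearW.
apply: powR_cvg0 => //; first by rewrite invr_gt0.
exact: fine_cvg.
Qed.
End Lp_convergence.

(** * One-sided mollification *)

Section mollification.
Context {R : realType}.
Notation mu := (@lebesgue_measure R).
Implicit Types (f g h eta : R -> R) (D : set R).

(** The convolution of h with the reflection of eta. *)
Definition correlation h eta (x : R) : R := \int[mu]_y (h y * eta (y - x)).

Definition bounded_measurable h : Prop :=
  measurable_fun setT h /\ exists C, forall x, `|h x| <= C.

Lemma test_function_subr eta x : test_function setT eta ->
  test_function setT (fun y => eta (y - x)).
Proof. exact: test_function_shift. Qed.

Lemma test_function_measurable D eta : test_function D eta -> measurable_fun setT eta.
Proof.
by move=> teta; apply: left_primitive_measurable (test_function_left_primitive teta).
Qed.

Lemma test_function_integrable D eta : test_function D eta ->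
  mu.-integrable setT (EFin \o eta).
Proof.
move=> te; have [C eC] := test_function_bounded te.
have [M _ eM] := compactly_supported_segment te.2.
exact: supported_integrable measurableT (test_function_measurable te) eC eM.
Qed.

Lemma bounded_measurableM_integrable h eta : bounded_measurable h ->
  test_function setT eta -> mu.-integrable setT (EFin \o (fun y => h y * eta y)).
Proof.
move=> [mh [C hC]] te; have [B eB] := test_function_bounded te.
have [M _ eM] := compactly_supported_segment te.2.
apply: (@supported_integrable _ _ _ (- M) M (C * B)) => //.
- apply: measurable_funM => //; exact: test_function_measurable te.
- by move=> x; rewrite normrM ler_pM.
- by move=> x; rewrite mulf_eq0 negb_or => /andP[_ /eM].
Qed.

Lemma correlation_is_derive h eta a b x : bounded_measurable h -> supported a b h ->
  test_function setT eta ->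
  is_derive x (1 : R) (correlation h eta) (correlation (fun y => - h y) (derive1 eta) x).
Proof.
move=> bh hab te; have te' := test_function_derive1 te.
have [C' eC'] := test_function_bounded te'.
have [mh [B hB]] := bh.
have De y z : is_derive z (1 : R) (fun z => h y * eta (y - z)) (- h y * derive1 eta (y - z)).
  have sh : is_derive z (1 : R) (fun z => y - z) (- 1).
    by rewrite -[X in is_derive _ _ _ X]sub0r; exact: is_deriveB.
  have := @is_derive1_comp _ eta (fun z => y - z) z _ _ (smooth_is_derive te.1 _) sh.
  move=> d1; have := @is_deriveZ _ _ _ _ (h y) _ _ _ d1.
  by rewrite /GRing.scale/= mulrN1 mulrN -mulNr.
have p1 : partial1of2 (fun z y => h y * eta (y - z)) = (fun z y => - h y * derive1 eta (y - z)).
  by apply/funext => z; apply/funext => y; rewrite partial1of2E; have [] := De y z.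
have xI : `]x - 1, x + 1[%classic x by rewrite /= in_itv/= ltrBlDr ltrDl ltr01.
have intf z : `]x - 1, x + 1[%classic z -> mu.-integrable setT (EFin \o (fun y => h y * eta (y - z))).
  by move=> _; apply: bounded_measurableM_integrable => //; exact: test_function_subr.
have derf z y : `]x - 1, x + 1[%classic z -> [set: R] y -> derivable (fun z => h y * eta (y - z)) z 1.
  by move=> _ _; have [] := De y z.
pose G y := C' * `|h y|.
have C'0 : 0 <= C' by exact: le_trans (normr_ge0 _) (eC' 0).
have G0 y : 0 <= G y by rewrite mulr_ge0.
have intG : mu.-integrable setT (EFin \o G).
  apply: (@supported_integrable _ _ _ a b (C' * B)) => //.
  - by apply: measurable_funM => //; exact: measurableT_comp.
  - by move=> y; rewrite (ger0_norm (G0 y)) ler_wpM2l.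
  - by move=> y; rewrite mulf_eq0 negb_or normr_eq0 => /andP[_ /hab].
have Gub z y : `]x - 1, x + 1[%classic z -> [set: R] y ->
    `|partial1of2 (fun z y => h y * eta (y - z)) z y| <= G y.
  by move=> _ _; rewrite p1 normrM normrN mulrC ler_wpM2r.
rewrite (_ : correlation (fun y => - h y) _ x = 'D_1 (correlation h eta) x).
  apply: DeriveDef => //.
  exact: (derivable_under_integral measurableT xI intf derf G0 intG Gub).
rewrite -derive1E.
rewrite (differentiation_under_integral measurableT xI intf derf G0 intG Gub).
by rewrite p1.
Qed.

Lemma correlation_smooth h eta a b : bounded_measurable h -> supported a b h ->
  test_function setT eta -> smooth (correlation h eta).
Proof.
move=> bh hab te.
pose P F := exists h eta, [/\ bounded_measurable h, supported a b h,
  test_function setT eta & F = correlation h eta].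
apply: (smooth_coind (P := P)); last by exists h, eta.
move=> _ [{bh hab}h [{te}eta [bh hab te ->]]].
have D x := correlation_is_derive x bh hab te.
split; first by move=> x; have [] := D x.
exists (fun y => - h y), (derive1 eta); split.
- have [mh [C hC]] := bh; split; first exact: measurableT_comp.
  by exists C => x; rewrite normrN.
- by move=> x; rewrite oppr_eq0 => /hab.
- exact: test_function_derive1.
- by apply/funext => x; rewrite derive1E; have [] := D x.
Qed.

Definition left_mollifier (e : R) eta : Prop :=
  [/\ test_function setT eta, forall x, 0 <= eta x, supported (- e) 0 eta &
      \int[mu]_x eta x = 1].

(** The value at x of the correlation is a weighted mean of h over [x - e, x]. *)
Lemma correlation_near h eta e c k x : bounded_measurable h -> left_mollifier e eta ->
  (forall y, x - e <= y -> y <= x -> `|h y - c| <= k) -> `|correlation h eta x - c| <= k.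
Proof.
move=> bh [te e0 es e1] hc.
have tex := test_function_subr x te.
have [_ ex1] := Rintegral_shift (- x) (test_function_integrable te).
have intx := test_function_integrable tex.
have inth := bounded_measurableM_integrable bh tex.
have inthc : mu.-integrable setT (EFin \o (fun y => (h y - c) * eta (y - x))).
  apply: bounded_measurableM_integrable => //; have [mh [C hC]] := bh.
  split; first exact: measurable_funB.
  by exists (C + `|c|) => y; rewrite (le_trans (ler_normB _ _))// lerD2r.
have -> : correlation h eta x - c = \int[mu]_y ((h y - c) * eta (y - x)).
  rewrite -[c in LHS]mulr1 -[in LHS]e1 -ex1 -RintegralZl// -RintegralB//.
    by apply: eq_Rintegral => y _; rewrite mulrBl.
  by have := integrableZl measurableT c intx.
rewrite (le_trans (le_normr_Rintegral _ _))//.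
rewrite -[leRHS]mulr1 -e1 -ex1 -RintegralZl//; apply: le_Rintegral => //.
- exact: integrable_norm.
- by have := integrableZl measurableT k intx.
- move=> y _; rewrite normrM (ger0_norm (e0 _)).
  have [->|/es/andP[ye yx]] := eqVneq (eta (y - x)) 0; first by rewrite !mulr0.
  by rewrite ler_wpM2r// hc; lra.
Qed.

(** The derivative falls on the kernel; integration by parts moves it to f. *)
Lemma left_primitive_correlation_derive1 f g eta a b : left_primitive f g ->
  supported a b f -> (exists C, forall x, `|f x| <= C) -> test_function setT eta ->
  derive1 (correlation f eta) = correlation g eta.
Proof.
move=> fg fab bf te; apply/funext => x.
have bmf : bounded_measurable f by split; [exact: left_primitive_measurable fg|].
have := correlation_is_derive x bmf fab te; rewrite derive1E => -[_ ->].
have := left_primitive_by_parts fg bf (test_function_subr x te).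
have -> : derive1 (fun y => eta (y - x)) = (fun y => derive1 eta (y - x)).
  apply/funext => y.
  have sh : is_derive y (1 : R) (fun z => z - x) 1.
    by apply: is_derive_eq; rewrite ?addr0 ?subr0.
  have := @is_derive1_comp _ eta (fun z => z - x) y _ _ (smooth_is_derive te.1 _) sh.
  by rewrite mulr1 => -[_ <-]; rewrite derive1E.
rewrite /correlation => E; apply: oppr_inj; rewrite -E -[RHS]opprK; congr (- _).
rewrite -[RHS]mulN1r -RintegralZl//.
  by apply: eq_Rintegral => y _; rewrite mulN1r mulNr.
apply: bounded_measurableM_integrable => //; apply: test_function_subr.
exact: test_function_derive1.
Qed.
End mollification.

Section H1_0_functions.
Context {R : realType}.
Notation mu := (@lebesgue_measure R).

(** The kernels have their support in [- e, 0], so the mollified functions only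
    spread to the right of b, and converge at x as soon as the limit is
    left-continuous at x. *)
Lemma left_primitive_H1_0 (p q a b : R) f g :
  (forall e : R, 0 < e -> exists eta, left_mollifier e eta) ->
  left_primitive f g -> p < a -> b < q -> a <= b -> supported a b f ->
  H1_0 `]p, q[%classic f.
Proof.
move=> mol fg pa bq ab fab; set D := `]p, q[%classic.
have oD : open D by exact: interval_open.
have mD : measurable D by exact: measurable_itv.
have Dfin : (mu D < +oo)%E by rewrite lebesgue_measure_itv/=; case: ifP; rewrite -?EFinB ltry.
have [[L fL] _] := fg.
have gL := left_primitive_bounded fg fL.
have bf := supported_lipschitz_bounded fL fab; have [C fC] := bf.
have mf := left_primitive_measurable fg.
have mg := left_primitive_measurable_derivative fg.
have bmf : bounded_measurable f by [].
have bmg : bounded_measurable g by split => //; exists L.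
have e0 k : 0 < (q - b) / 2 / k.+1%:R by rewrite !divr_gt0// subr_gt0.
pose eta k := projT1 (cid (mol _ (e0 k))).
have eta_mol k : left_mollifier ((q - b) / 2 / k.+1%:R) (eta k) := projT2 (cid (mol _ (e0 k))).
have teta k : test_function setT (eta k) by have [] := eta_mol k.
have tF k : test_function D (correlation f (eta k)).
  split; first exact: correlation_smooth bmf fab (teta k).
  apply: (@segment_compactly_supported _ _ _ a (b + (q - b) / 2)); last first.
    by move=> x; rewrite /D/= !in_itv/= => /andP[? ?]; apply/andP; split; lra.
  move=> x; apply: contraPT => xab; apply/negP; rewrite negbK; apply/eqP.
  have [te _ es _] := eta_mol k.
  rewrite /correlation (@eq_Rintegral _ _ _ mu _ (cst 0)); last first.
    move=> y _ /=; apply/eqP; rewrite mulf_eq0; apply/orP.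
    have [|/fab/andP[ay yb]] := eqVneq (f y) 0; [by left|right].
    have [//|/es/andP[yx xy]] := eqVneq (eta k (y - x)) 0.
    have ek : (q - b) / 2 / k.+1%:R <= (q - b) / 2.
      by rewrite ler_pdivrMr// ler_peMr ?ler1n// divr_ge0// subr_ge0 ltW.
    move: ek yx xy; set t := _ / k.+1%:R => ek yx xy.
    by move/negP : xab; case; apply/andP; split; lra.
  by rewrite Rintegral_cst// mul0r.
have dF k : derive1 (correlation f (eta k)) = correlation g (eta k).
  exact: left_primitive_correlation_derive1 fg fab bf (teta k).
have tF' k : test_function D (correlation g (eta k)).
  by rewrite -dF; exact: test_function_derive1.
have wF k : weak_derivative D (correlation f (eta k)) (correlation g (eta k)).
  apply: left_primitive_weak_derivative => //.
    by rewrite -dF; exact: test_function_left_primitive (tF k).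
  exact: test_function_bounded (tF k).
have cvgc h C' : bounded_measurable h -> (forall x, `|h x| <= C') -> left_continuous setT h ->
    (forall k, measurable_fun setT (correlation h (eta k))) ->
    Lp_cvg D 2%:E (fun k => correlation h (eta k)) h.
  move=> bmh hC' lch mc; apply: (@bounded_Lp_cvg _ _ mD Dfin _ _ _ _ C') => //.
  - exact: bmh.1.
  - move=> k x; rewrite -[correlation _ _ _]subr0.
    by apply: (correlation_near bmh (eta_mol k)) => y _ _; rewrite subr0.
  - apply: aeW => x _; apply/cvgrPdist_le => e ep.
    have [d d0 hd] := lch x I e ep.
    have de : 0 < d / ((q - b) / 2) by rewrite !divr_gt0// subr_gt0.
    near=> k; rewrite distrC; apply: (correlation_near bmh (eta_mol k)) => y xy yx.
    apply: hd => //; apply: lt_le_trans xy; rewrite ltrD2l ltrN2.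
    rewrite mulrC -ltr_pdivlMr ?divr_gt0 ?subr_gt0//.
    by near: k; exact: near_infty_natSinv_lt (PosNum de).
exists (fun k => correlation f (eta k)) => //; split.
  apply: (cvgc _ C) => //.
    move=> x _ e ep; have : continuous f by exact: left_primitive_continuous fg.
    move=> /(_ x)/cvgrPdist_le/(_ _ ep)/nbhs_ballP[d /= d0 fd].
    exists d => // y _ xy yx; rewrite distrC; apply: fd; rewrite /ball/=.
    by rewrite ger0_norm; lra.
  by move=> k; exact: test_function_measurable (tF k).
exists (fun k => correlation g (eta k)), g; split=> //.
  by apply: left_primitive_weak_derivative.
apply: (cvgc _ L) => //; first exact: left_primitive_left_continuous fg.
by move=> k; exact: test_function_measurable (tF' k).
Unshelve. all: by end_near. Qed.
End H1_0_functions.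

(** * The support of the second derivative *)

Section support.
Context {R : realType}.
Notation mu := (@lebesgue_measure R).
Implicit Types (f g h eta psi u s : R -> R) (D : set R).

Lemma test_function_Rintegral_gt0 D h z : test_function D h -> (forall x, 0 <= h x) ->
  h z != 0 -> 0 < \int[mu]_x h x.
Proof.
move=> th h0 hz; have {}hz : 0 < h z by rewrite lt_neqAle eq_sym hz h0.
have ch : continuous h by apply: smooth_continuous th.1.
have hz2 : 0 < h z / 2 by rewrite divr_gt0.
have /cvgrPdist_le/(_ _ hz2)/nbhs_ballP[r /= r0 hr] := ch z.
pose K := `[z - r / 2, z + r / 2]%classic.
have iK : mu.-integrable setT (EFin \o \1_K) by exact: integrable_indic_itv.
have mK : measurable K by exact: measurable_itv.
apply: (@lt_le_trans _ _ (\int[mu]_x (h z / 2 * \1_K x))).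
  have muK : mu K = r%:E.
    rewrite /K lebesgue_measure_itv/= lte_fin ifT; last by lra.
    by rewrite -EFinB; congr EFin; lra.
  by rewrite RintegralZl// mulr_gt0// /Rintegral integral_indic// setIT [X in fine X]muK.
apply: le_Rintegral => //.
- by have := integrableZl measurableT (h z / 2) iK.
- exact: test_function_integrable th.
move=> x _; rewrite indicE; have [|xK] := boolP (x \in K); last by rewrite mulr0.
rewrite inE /K/= in_itv/= mulr1 => /andP[zx xz].
have : ball z r x by rewrite /ball/= ltr_norml; apply/andP; split; lra.
by move/hr; rewrite ler_norml => /andP[_]; lra.
Qed.

Lemma second_derivativeE D u psi :
  second_derivative D u psi = regular_distribution D u (derive1 (derive1 psi)).
Proof. by rewrite /second_derivative /distributional_derivative opprK. Qed.

(** The definition of the support provides, near x0, a test function psi on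
    which the distribution does not vanish; psi is then nonzero, and psi^2,
    translated to the left of 0 and normalized, is a mollifier. *)
Lemma support_mollifier D u x0 : distribution_support D (second_derivative D u) x0 ->
  forall e, 0 < e -> exists eta, left_mollifier e eta.
Proof.
move=> [Dx0 sx0] e e0; have e20 : 0 < e / 2 by rewrite divr_gt0.
have [||psi tpsi] := sx0 `]x0 - e / 2, x0 + e / 2[%classic.
- exact: interval_open.
- by rewrite /= in_itv/= ltrBlDr !ltrDl e20.
move=> Tpsi; have [z psiz] : exists z, psi z != 0.
  apply: contrapT => nz; move/eqP : Tpsi; apply.
  have -> : psi = cst 0.
    by apply/funext => z; apply/eqP; apply: contra_notT nz => ?; exists z.
  rewrite second_derivativeE /regular_distribution.
  have d0 : derive1 (cst 0 : R -> R) = cst 0 by apply/funext => y; rewrite derive1_cst.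
  rewrite !d0 (@eq_Rintegral _ _ _ mu _ (fun=> 0 * 0)); last by move=> y _; rewrite /= !mulr0.
  rewrite /Rintegral (@eq_integral _ _ _ mu _ (cst 0%E)) ?integral0//.
  by move=> y _; rewrite mulr0.
have tpsi2 := test_function_setT (test_functionM tpsi.1 tpsi).
pose c := x0 + e / 2.
have tphi := test_function_shift c tpsi2.
set phi := (fun x => _) in tphi.
have phi0 x : 0 <= phi x by rewrite /phi; exact: sqr_ge0.
have int0 : 0 < \int[mu]_x phi x.
  apply: (test_function_Rintegral_gt0 (z := z - c) tphi phi0).
  by rewrite /phi subrK mulf_neq0.
set C := \int[mu]_x phi x in int0.
have etaE x : ((fun x => 0 * x + C^-1) * phi) x = C^-1 * phi x.
  by change ((0 * x + C^-1) * phi x = C^-1 * phi x); rewrite mul0r add0r.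
exists ((fun x => 0 * x + C^-1) * phi); split.
- by apply: test_functionM tphi; exact: smooth_affine.
- by move=> x; rewrite etaE mulr_ge0// invr_ge0 ltW.
- move=> x; rewrite etaE mulf_eq0 negb_or => /andP[_].
  rewrite mulf_eq0 negb_or => /andP[pxc _].
  have [_ /=] := test_function_subset tpsi pxc.
  by rewrite in_itv/= /c => /andP[? ?]; apply/andP; split; lra.
- rewrite (@eq_Rintegral _ _ _ mu _ (fun x => C^-1 * phi x)).
    by rewrite RintegralZl ?mulVf ?gt_eqF//; exact: test_function_integrable tphi.
  by move=> x _; exact: etaE.
Qed.

Lemma Rintegral_test_function_derive1 D psi : test_function D psi ->
  \int[mu]_x derive1 psi x = 0.
Proof.
move=> tpsi; have pg := test_function_left_primitive tpsi; have [[M psiM] _] := pg.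
have [r _ psir] := compactly_supported_segment tpsi.2.
by apply: (Rintegral_left_derivative psiM psir) => x; exact: left_primitive_cvg.
Qed.

(** If l is affine with slope p, then l psi'' = (l psi')' - p psi', whose integral
    is 0. *)
Lemma affine_second_derivative D u a b c p : measurable D ->
  (forall x, a < x -> x < b -> u x = p * x + c) ->
  forall psi, test_function (D `&` `]a, b[) psi -> second_derivative D u psi = 0.
Proof.
move=> mD uab psi tpsi.
have tpsi' := test_function_derive1 tpsi.
have tpsi'' := test_function_derive1 tpsi'.
rewrite second_derivativeE regular_distributionE//; last first.
  by move=> x /(test_function_subset tpsi'')[].
pose l (x : R) := p * x + c.
have sl : smooth l by exact: smooth_affine.
have tlp := test_functionM sl tpsi'.
have i1 := test_function_integrable tpsi'.
have i2 := test_function_integrable (test_function_derive1 tlp).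
transitivity (\int[mu]_x (derive1 (l * derive1 psi) x - p * derive1 psi x)).
  apply: eq_Rintegral => x _.
  have dl : is_derive x (1 : R) l p.
    by apply: is_derive_eq; rewrite addr0 /GRing.scale/= mulr1.
  have -> : derive1 (l * derive1 psi) x = l x * derive1 (derive1 psi) x + derive1 psi x * p.
    by have [_ <-] := is_deriveM dl (smooth_is_derive tpsi'.1 x); rewrite derive1E.
  rewrite [p * _]mulrC addrK.
  have [->|/(test_function_subset tpsi'')[_]] := eqVneq (derive1 (derive1 psi) x) 0.
    by rewrite !mulr0.
  by rewrite /= in_itv/= => /andP[? ?]; rewrite uab.
rewrite RintegralB//; last by have := integrableZl measurableT p i1.
rewrite RintegralZl// (Rintegral_test_function_derive1 tpsi).
by rewrite (Rintegral_test_function_derive1 tlp) mulr0 subrr.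
Qed.

(** If s a = s b, then s is constant on [a, b] and u is affine there. *)
Lemma support_subgradient_lt (p q : R) u s x0 a b : let D := `]p, q[%classic in
  subgradient D u s -> distribution_support D (second_derivative D u) x0 ->
  D a -> D b -> a < x0 -> x0 < b -> s a < s b.
Proof.
move=> D sg [Dx0 sx0] Da Db ax xb; rewrite ltNge; apply/negP => sba.
have [||psi tpsi] := sx0 `]a, b[%classic.
- exact: interval_open.
- by rewrite /= in_itv/= ax.
move/eqP; apply; apply: (affine_second_derivative (p := s a) (c := u a - s a * a)) tpsi.
  exact: measurable_itv.
move=> x ax' xb'.
have Dx : D x.
  move: Da Db; rewrite /D/= !in_itv/= => /andP[? ?] /andP[? ?].
  by apply/andP; split; lra.
have sx : s x = s a.
  apply/eqP; rewrite eq_le (subgradient_le sg Da Dx (ltW ax')) andbT.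
  exact: le_trans (subgradient_le sg Dx Db (ltW xb')) sba.
have := sg _ _ Da Dx; have := sg _ _ Dx Da; rewrite /bregman sx; lra.
Qed.
End support.

(** * Hats as combinations of three ramps *)

Section tents.
Context {R : realType}.
Implicit Types (f g u s : R -> R) (m v w : R).

(** Up to the factor m3 - m1, the second divided difference of the values v at
    the nodes m: it kills the affine functions of the nodes, which is why a
    combination of ramps with these coefficients has compact support. *)
Definition tent m1 m2 m3 v1 v2 v3 : R :=
  (v1 - v2) / (m2 - m1) - (v2 - v3) / (m3 - m2).

Lemma tentB m1 m2 m3 v1 v2 v3 w1 w2 w3 :
  tent m1 m2 m3 v1 v2 v3 - tent m1 m2 m3 w1 w2 w3 =
  tent m1 m2 m3 (v1 - w1) (v2 - w2) (v3 - w3).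
Proof. by rewrite /tent; ring. Qed.

Lemma ler_norm_tent m1 m2 m3 v1 v2 v3 k : m1 < m2 -> m2 < m3 ->
  `|v1| <= k -> `|v2| <= k -> `|v3| <= k ->
  `|tent m1 m2 m3 v1 v2 v3| <= 2 * k * ((m2 - m1)^-1 + (m3 - m2)^-1).
Proof.
move=> m12 m23 v1k v2k v3k.
have i1 : 0 <= (m2 - m1)^-1 by rewrite invr_ge0 subr_ge0 ltW.
have i2 : 0 <= (m3 - m2)^-1 by rewrite invr_ge0 subr_ge0 ltW.
rewrite /tent (le_trans (ler_normB _ _))// mulrDr.
rewrite !normrM (ger0_norm i1) (ger0_norm i2) lerD// ler_wpM2r//.
  by rewrite (le_trans (ler_normB _ _))//; lra.
by rewrite (le_trans (ler_normB _ _))//; lra.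
Qed.

Lemma left_primitive_tent m1 m2 m3 f1 g1 f2 g2 f3 g3 :
  left_primitive f1 g1 -> left_primitive f2 g2 -> left_primitive f3 g3 ->
  left_primitive (fun x => tent m1 m2 m3 (f1 x) (f2 x) (f3 x))
                 (fun x => tent m1 m2 m3 (g1 x) (g2 x) (g3 x)).
Proof.
move=> fg1 fg2 fg3.
have tE (h1 h2 h3 : R -> R) : (fun x => tent m1 m2 m3 (h1 x) (h2 x) (h3 x)) =
    (fun x => (m2 - m1)^-1 * h1 x + (- ((m2 - m1)^-1 + (m3 - m2)^-1) * h2 x +
      (m3 - m2)^-1 * h3 x)).
  by apply/funext => x; rewrite /tent; ring.
rewrite !tE; apply: left_primitiveD; first exact: left_primitiveZ.
by apply: left_primitiveD; exact: left_primitiveZ.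
Qed.

Lemma hatE m1 m2 m3 x : m1 < m2 -> m2 < m3 ->
  hat m1 m2 m3 x = tent m1 m2 m3 (ramp m1 x) (ramp m2 x) (ramp m3 x).
Proof.
move=> m12 m23; rewrite /hat /tent /ramp.
have n1 : m2 - m1 != 0 by rewrite subr_eq0 gt_eqF.
have n2 : m3 - m2 != 0 by rewrite subr_eq0 gt_eqF.
have r0 (y : R) : y <= 0 -> Num.max y 0 = 0 by move=> ?; rewrite max_r.
have r1 (y : R) : 0 <= y -> Num.max y 0 = y by move=> ?; rewrite max_l.
case: ifPn => [/andP[m1x xm2]|/negP n12].
  rewrite (r1 (x - m1)) ?(r0 (x - m2)) ?(r0 (x - m3)); [|lra..].
  by field; rewrite n1 n2.
case: ifPn => [/andP[m2x xm3]|/negP n23].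
  rewrite (r1 (x - m1)) ?(r1 (x - m2)) ?(r0 (x - m3)); [|lra..].
  by field; rewrite n1 n2.
have [xm1|m1x] := ltP x m1.
  by rewrite !r0; [ring|lra..].
have m2x : m2 < x by rewrite ltNge; apply/negP => xm2; apply: n12; rewrite m1x.
have m3x : m3 < x by rewrite ltNge; apply/negP => xm3; apply: n23; rewrite (ltW m2x).
by rewrite !r1; [field; rewrite n1 n2|lra..].
Qed.

Lemma hat_outside m1 m2 m3 x : m1 < m2 -> m2 < m3 -> (x <= m1) || (m3 <= x) ->
  hat m1 m2 m3 x = 0.
Proof.
move=> m12 m23 xm; rewrite hatE// /tent /ramp.
have n1 : m2 - m1 != 0 by rewrite subr_eq0 gt_eqF.
have n2 : m3 - m2 != 0 by rewrite subr_eq0 gt_eqF.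
case/orP : xm => xm.
  by rewrite !max_r ?subr_le0; [ring|lra..].
by rewrite !max_l ?subr_ge0; [field; rewrite n1 n2|lra..].
Qed.

Lemma hat_left m1 m2 m3 x : m1 < m2 -> m2 < m3 -> x <= m2 ->
  hat m1 m2 m3 x = ramp m1 x / (m2 - m1).
Proof.
move=> m12 m23 xm; rewrite hatE// /tent [ramp m2 x]max_r ?[ramp m3 x]max_r ?subr_le0//.
  by rewrite !subr0 mul0r subr0.
lra.
Qed.

Lemma hat_right m1 m2 m3 x : m1 < m2 -> m2 < m3 -> m2 <= x ->
  hat m1 m2 m3 x = (m3 - x + ramp m3 x) / (m3 - m2).
Proof.
move=> m12 m23 mx; rewrite hatE// /tent.
have n1 : m2 - m1 != 0 by rewrite subr_eq0 gt_eqF.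
have n2 : m3 - m2 != 0 by rewrite subr_eq0 gt_eqF.
rewrite [ramp m1 x]max_l ?[ramp m2 x]max_l ?subr_ge0//; last lra.
by field; rewrite n1 n2.
Qed.

Lemma hat_bounds m1 m2 m3 x : m1 < m2 -> m2 < m3 -> 0 <= hat m1 m2 m3 x <= 1.
Proof.
move=> m12 m23.
have [xm|/ltW xm] := leP x m2.
  rewrite hat_left// divr_ge0 ?le_max ?lexx ?orbT ?subr_ge0 ?(ltW m12)//=.
  rewrite ler_pdivrMr ?subr_gt0// mul1r ge_max lerB//= subr_ge0; exact: ltW.
rewrite hat_right//; have : 0 <= m3 - x + ramp m3 x <= m3 - m2.
  by rewrite /ramp; case: (leP (x - m3) 0) => ?; apply/andP; split; lra.
move=> /andP[h1 h2]; rewrite divr_ge0 ?subr_ge0 ?(ltW m23)//=.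
by rewrite ler_pdivrMr ?subr_gt0// mul1r.
Qed.

Lemma hat_left_primitive m1 m2 m3 : m1 < m2 -> m2 < m3 -> left_primitive (hat m1 m2 m3)
  (fun x => tent m1 m2 m3 (m1 < x)%R%:R (m2 < x)%R%:R (m3 < x)%R%:R).
Proof.
move=> m12 m23.
rewrite (_ : hat m1 m2 m3 =
    fun x => tent m1 m2 m3 (ramp m1 x) (ramp m2 x) (ramp m3 x)).
  by apply: left_primitive_tent; exact: ramp_left_primitive.
by apply/funext => x; exact: hatE.
Qed.

Lemma cvg_ramp (m_ : nat -> R) m x : m_ k @[k --> \oo] --> m ->
  ramp (m_ k) x @[k --> \oo] --> ramp m x.
Proof.
move=> cm.
have rE y : ramp y x = (x - y + `|x - y|) / 2 by rewrite /ramp maxr_absE addr0 subr0.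
under eq_cvg do rewrite rE.
have cx : x - m_ k @[k --> \oo] --> x - m by apply: cvgB => //; exact: cvg_cst.
by rewrite rE; apply: cvgMl; apply: cvgD => //; exact: cvg_norm.
Qed.

Lemma cvg_tent (m1 m2 m3 v1 v2 v3 : nat -> R) n1 n2 n3 w1 w2 w3 :
  n1 < n2 -> n2 < n3 ->
  m1 k @[k --> \oo] --> n1 -> m2 k @[k --> \oo] --> n2 -> m3 k @[k --> \oo] --> n3 ->
  v1 k @[k --> \oo] --> w1 -> v2 k @[k --> \oo] --> w2 -> v3 k @[k --> \oo] --> w3 ->
  tent (m1 k) (m2 k) (m3 k) (v1 k) (v2 k) (v3 k) @[k --> \oo] --> tent n1 n2 n3 w1 w2 w3.
Proof.
move=> n12 n23 cm1 cm2 cm3 cv1 cv2 cv3.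
apply: cvgB; apply: cvgM; [exact: cvgB|apply: cvgV|exact: cvgB|apply: cvgV].
- by rewrite subr_eq0 gt_eqF.
- exact: cvgB.
- by rewrite subr_eq0 gt_eqF.
- exact: cvgB.
Qed.

(** The divergence of u + t f is d_u + t d_f >= (1 - |t| C) d_u. *)
Lemma dominated_bregman_preserves_convexity (p q : R) u s f g :
  let D := `]p, q[%classic in subgradient D u s ->
  (exists C, forall x y, D x -> D y -> `|bregman f g x y| <= C * bregman u s x y) ->
  preserves_convexity D u f.
Proof.
move=> D sg [C fC]; have C1 : 0 < `|C| + 1 by rewrite ltr_wpDl.
exists (`|C| + 1)^-1; first by rewrite invr_gt0.
move=> t; rewrite in_itv/= -ler_norml => tC.
apply: (@subgradient_convex _ _ _ (fun x => s x + t * g x)).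
  move=> l x y l0 l1; rewrite /D/= !in_itv/= => /andP[px xq] /andP[py yq].
  have l1' : 0 <= 1 - l by rewrite subr_ge0.
  have [l00|ln0] := eqVneq l 0; first by rewrite l00 mul0r add0r subr0 mul1r py.
  have lp : 0 < l by rewrite lt_neqAle eq_sym ln0.
  have := ler_wpM2l l1' (ltW py); have := ler_wpM2l l1' (ltW yq).
  have := ltr_pM2l lp p x; have := ltr_pM2l lp x q; rewrite px xq => h1 h2 h3 h4.
  by apply/andP; split; lra.
move=> x y Dx Dy.
have -> : bregman (fun x => u x + t * f x) (fun x => s x + t * g x) x y =
    bregman u s x y + t * bregman f g x y by rewrite /bregman; ring.
have B0 := sg _ _ Dx Dy.
have h : `|t * bregman f g x y| <= bregman u s x y.
  rewrite normrM (le_trans (ler_pM _ _ tC (fC _ _ Dx Dy)))//.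
  rewrite mulrA ler_piMl// mulrC ler_pdivrMr// mul1r.
  by rewrite (le_trans (ler_norm _))// lerDl.
by move: h; rewrite ler_norml => /andP[? _]; lra.
Qed.
End tents.

(** * Approximation of hats by functions that preserve convexity *)

Section approximation.
Context {R : realType}.
Notation mu := (@lebesgue_measure R).
Variables (p q : R) (u s : R -> R).
Let D : set R := `]p, q[%classic.

(** What membership of x in the support of u'' means for the left derivative s. *)
Definition increases_across (x : R) : Prop := [/\ p < x, x < q &
  forall a b, p < a -> a < x -> x < b -> b < q -> s a < s b].

Definition admissible (f : R -> R) : Prop :=
  [/\ H1_0 D f, preserves_convexity D u f & compactly_supported D f].

Hypothesis sg : subgradient D u s.
Hypothesis cs : left_continuous D s.
Hypothesis mol : forall e : R, 0 < e -> exists eta, left_mollifier e eta.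

Let DE x : D x <-> p < x /\ x < q.
Proof. by rewrite /D/= in_itv/=; split=> [/andP[]|[-> ->]]. Qed.

Lemma local_ramp (x0 d : R) : increases_across x0 -> 0 < d -> p < x0 - d -> x0 + d < q ->
  exists m V g, [/\ `|m - x0| <= d, left_primitive V g,
    (exists C, forall x y, D x -> D y -> `|bregman V g x y| <= C * bregman u s x y),
    (forall x, (x <= x0 - d) || (x0 + d <= x) -> V x = ramp m x) &
    [/\ (forall x, `|V x - ramp m x| <= 2 * d),
    (forall x, d < `|x - x0| -> g x = (m < x)%R%:R) &
    (forall x, `|g x| <= 1)]].
Proof.
move=> [px xq sx] d0 pd dq.
have [||||m [V [g [mx Vg VC Ve [Vr gr g1]]]]] :=
  @exists_ramp _ p q u s (x0 - d) (x0 + d) sg cs.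
- by apply/DE; split; lra.
- by apply/DE; split; lra.
- lra.
- by apply: sx => //; lra.
exists m, V, g; split => //; first by rewrite ler_distl.
split=> [x|x xd|x].
- by rewrite (le_trans (Vr x))//; lra.
- apply: gr; move: xd; have [xx|xx] := leP x0 x.
    by rewrite ger0_norm ?subr_ge0// => ?; apply/orP; right; lra.
  by rewrite ltr0_norm ?subr_lt0// => ?; apply/orP; left; lra.
- by have /andP[? ?] := g1 x; rewrite ger0_norm.
Qed.

(** Ramps regularized over intervals of half-length d stay within 2 d of the true
    ones, and the combination multiplies the error by 2 / (m2 - m1) +
    2 / (m3 - m2), a bounded factor since d is small compared with the
    gaps between the nodes. *)
Lemma tent_approximation (x1 x2 x3 e : R) : increases_across x1 -> increases_across x2 -> increases_across x3 ->
  x1 < x2 -> x2 < x3 -> 0 < e ->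
  exists m1 m2 m3 f g,
  [/\ [/\ m1 < m2, m2 < m3, `|m1 - x1| <= e, `|m2 - x2| <= e & `|m3 - x3| <= e],
      left_primitive f g, admissible f,
      (forall x, `|f x - hat m1 m2 m3 x| <= e) &
      (forall x, e < `|x - x1| -> e < `|x - x2| -> e < `|x - x3| ->
         g x = tent m1 m2 m3 (m1 < x)%R%:R (m2 < x)%R%:R (m3 < x)%R%:R) /\
      (forall x, `|g x| <= 4 * ((x2 - x1)^-1 + (x3 - x2)^-1))].
Proof.
move=> sx1 sx2 sx3 x12 x23 e0.
have [px1 _ _] := sx1; have [_ x3q _] := sx3.
pose K := (x2 - x1)^-1 + (x3 - x2)^-1.
have K0 : 0 < K by rewrite addr_gt0// invr_gt0 subr_gt0.
have [d [d0 de [pd dq] [d12 d23] dK]] : exists d : R, [/\ 0 < d, d <= e, p < x1 - d /\ x3 + d < q,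
    4 * d <= x2 - x1 /\ 4 * d <= x3 - x2 & 8 * d * K <= e].
  pose d := Num.min e (Num.min ((x1 - p) / 2) (Num.min ((q - x3) / 2)
    (Num.min ((x2 - x1) / 4) (Num.min ((x3 - x2) / 4) (e / (8 * K)))))).
  have : d <= d by [].
  rewrite {2}/d !le_min => /and5P[de d1 d2 d3 /andP[d4 d5]].
  exists d; split=> //.
  - by rewrite /d !lt_min e0 !divr_gt0 ?mulr_gt0 ?subr_gt0.
  - by split; lra.
  - by split; lra.
  - by move: d5; rewrite ler_pdivlMr ?mulr_gt0//; lra.
have [||m1 [V1 [g1 [mx1 Vg1 [C1 VC1] Ve1 [Vr1 gr1 gb1]]]]] := local_ramp sx1 d0; [lra..|].
have [||m2 [V2 [g2 [mx2 Vg2 [C2 VC2] Ve2 [Vr2 gr2 gb2]]]]] := local_ramp sx2 d0; [lra..|].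
have [||m3 [V3 [g3 [mx3 Vg3 [C3 VC3] Ve3 [Vr3 gr3 gb3]]]]] := local_ramp sx3 d0; [lra..|].
have := mx1; have := mx2; have := mx3; rewrite !ler_distl.
move=> /andP[? ?] /andP[? ?] /andP[? ?].
have m12 : m1 < m2 by lra.
have m23 : m2 < m3 by lra.
have mK : (m2 - m1)^-1 + (m3 - m2)^-1 <= 2 * K.
  have i (y z : R) : 0 < z -> z <= 2 * y -> y^-1 <= 2 * z^-1.
    move=> z0 zy; have y0 : 0 < y by lra.
    by rewrite -ler_pdivrMl// -invfM lef_pV2 ?posrE ?mulr_gt0// mulrC; lra.
  by rewrite /K mulrDr lerD// i; lra.
pose f x := tent m1 m2 m3 (V1 x) (V2 x) (V3 x).
pose g x := tent m1 m2 m3 (g1 x) (g2 x) (g3 x).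
have fg : left_primitive f g by exact: left_primitive_tent.
have supf : supported (x1 - d) (x3 + d) f.
  move=> x; apply: contraPT => xab; apply/negP; rewrite negbK; apply/eqP.
  have xo : (x <= x1 - d) || (x3 + d <= x).
    by move: xab; rewrite negb_and -!ltNge => /orP[/ltW ->|/ltW ->]; rewrite ?orbT.
  rewrite /f Ve1 ?Ve2 ?Ve3; [|case/orP : xo => ?; apply/orP; (by left; lra) || (by right; lra)..].
  rewrite -hatE// hat_outside//.
  by case/orP : xo => ?; apply/orP; [left|right]; lra.
exists m1, m2, m3, f, g; split=> //.
- by split=> //; exact: le_trans de.
- split.
  + by apply: (left_primitive_H1_0 mol fg pd dq _ supf); lra.
  + apply: (dominated_bregman_preserves_convexity sg (g := g)).
    pose C := `|C1| + `|C2| + `|C3|.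
    exists (2 * C * ((m2 - m1)^-1 + (m3 - m2)^-1)) => x y Dx Dy.
    have B0 := sg Dx Dy.
    have -> : bregman f g x y =
        tent m1 m2 m3 (bregman V1 g1 x y) (bregman V2 g2 x y) (bregman V3 g3 x y).
      by rewrite /bregman /f /g /tent; ring.
    have Ci (C' b : R) : `|C'| <= C -> b <= C' * bregman u s x y -> b <= C * bregman u s x y.
      by move=> C'C /le_trans; apply; rewrite ler_wpM2r// (le_trans (ler_norm _)).
    rewrite [leRHS](_ : _ = 2 * (C * bregman u s x y) * ((m2 - m1)^-1 + (m3 - m2)^-1)); last first.
      by ring.
    apply: (ler_norm_tent m12 m23).
    * by apply: Ci (VC1 _ _ Dx Dy); rewrite /C -addrA lerDl addr_ge0.
    * by apply: Ci (VC2 _ _ Dx Dy); rewrite /C addrAC lerDr addr_ge0.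
    * by apply: Ci (VC3 _ _ Dx Dy); rewrite /C lerDr addr_ge0.
  + apply: segment_compactly_supported supf _ => x /=; rewrite in_itv/= => /andP[? ?].
    by apply/DE; split; lra.
- move=> x; rewrite hatE// tentB.
  apply: le_trans (ler_norm_tent (k := 2 * d) m12 m23 (Vr1 x) (Vr2 x) (Vr3 x)) _.
  apply: le_trans dK.
  have -> : 8 * d * K = 2 * (2 * d) * (2 * K) by ring.
  by rewrite ler_wpM2l// mulr_ge0// mulr_ge0// ltW.
split=> x.
- by move=> xe1 xe2 xe3; rewrite /g gr1 ?gr2 ?gr3//; exact: le_lt_trans de _.
- apply: le_trans (ler_norm_tent (k := 1) m12 m23 (gb1 x) (gb2 x) (gb3 x)) _.
  by rewrite mulr1 (_ : 4 = 2 * 2) -?mulrA ?ler_wpM2l//; ring.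
Qed.
End approximation.

(** * Sequences of approximations *)

Section limits.
Context {R : realType}.
Notation mu := (@lebesgue_measure R).

Lemma ae_off_countable (A : set R) (P : R -> Prop) : countable A ->
  (forall x, ~ A x -> P x) -> {ae mu, forall x, P x}.
Proof.
move=> cA AP; exists A; split.
- exact: countable_measurable.
- exact: countable_lebesgue_measure0.
- by move=> x /= nP; apply: contrapT => /AP.
Qed.

Lemma cvg_harmonic_bound (m_ : nat -> R) (x C : R) :
  (forall k, `|m_ k - x| <= C / k.+1%:R) -> m_ k @[k --> \oo] --> x.
Proof.
move=> mC; apply/subr_cvg0/norm_cvg0P.
apply: (@squeeze_cvgr _ _ _ _ (cst 0) (fun k => C / k.+1%:R)).
- by apply: nearW => k; rewrite normr_ge0 mC.
- exact: cvg_cst.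
- by rewrite -(mulr0 C); apply: cvgMr; exact: cvg_harmonic.
Qed.

Lemma hat_indicator_measurable (x1 x2 x3 : R) (A : set R) : x1 < x2 -> x2 < x3 ->
  measurable A -> measurable_fun setT (fun x => hat x1 x2 x3 x * \1_A x).
Proof.
move=> x12 x23 mA; apply: measurable_funM; last exact: measurable_indic.
exact: left_primitive_measurable (hat_left_primitive x12 x23).
Qed.

Lemma hat_indicator_bounded (x1 x2 x3 : R) (A : set R) x : x1 < x2 -> x2 < x3 ->
  `|hat x1 x2 x3 x * \1_A x| <= 1.
Proof.
move=> x12 x23; have /andP[h0 h1] := hat_bounds x x12 x23.
rewrite normrM ger0_norm// indicE; case: (x \in A); first by rewrite normr1 mulr1.
by rewrite normr0 mulr0.
Qed.

(** The right half of the hat is squeezed into x2; the left half is close to the left half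
    of the limit hat. *)
Lemma cvg_hat_left (m1 m2 m3 : nat -> R) (x1 x2 x3 x : R) :
  (forall k, m1 k < m2 k) -> (forall k, m2 k < m3 k) -> x1 < x2 -> x2 < x3 ->
  m1 k @[k --> \oo] --> x1 -> m2 k @[k --> \oo] --> x2 -> m3 k @[k --> \oo] --> x2 ->
  x != x2 ->
  hat (m1 k) (m2 k) (m3 k) x @[k --> \oo] --> hat x1 x2 x3 x * \1_(`]x1, x2[%classic) x.
Proof.
move=> m12 m23 x12 x23 c1 c2 c3 xx2.
have [x2x|xx2'|/eqP] := ltgtP x2 x; last by rewrite eq_sym (negbTE xx2).
  rewrite indicE memNset; last by rewrite /= in_itv/= => /andP[_]; lra.
  rewrite mulr0; apply: cvg_near_cst.
  have /cvgr_lt/(_ _ x2x) := c3; apply: filterS => k m3x.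
  by rewrite hat_outside// (ltW m3x) orbT.
have -> : hat x1 x2 x3 x * \1_(`]x1, x2[%classic) x = ramp x1 x / (x2 - x1).
  rewrite hat_left ?(ltW xx2')// indicE.
  have [x1x|xx1] := ltP x1 x; first by rewrite mem_set ?mulr1//= in_itv/= x1x.
  by rewrite /ramp max_r ?subr_le0// !mul0r.
have C : ramp (m1 k) x / (m2 k - m1 k) @[k --> \oo] --> ramp x1 x / (x2 - x1).
  apply: cvgM; first exact: cvg_ramp.
  by apply: cvgV; [rewrite subr_eq0 gt_eqF|exact: cvgB].
apply: cvg_trans C; apply: near_eq_cvg.
have /cvgr_gt/(_ _ xx2') := c2; apply: filterS => k /ltW xm2.
by rewrite hat_left.
Qed.

Lemma cvg_hat_right (m1 m2 m3 : nat -> R) (x1 x2 x3 x : R) :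
  (forall k, m1 k < m2 k) -> (forall k, m2 k < m3 k) -> x1 < x2 -> x2 < x3 ->
  m1 k @[k --> \oo] --> x2 -> m2 k @[k --> \oo] --> x2 -> m3 k @[k --> \oo] --> x3 ->
  x != x2 ->
  hat (m1 k) (m2 k) (m3 k) x @[k --> \oo] --> hat x1 x2 x3 x * \1_(`]x2, x3[%classic) x.
Proof.
move=> m12 m23 x12 x23 c1 c2 c3 xx2.
have [x2x|xx2'|/eqP] := ltgtP x2 x; last by rewrite eq_sym (negbTE xx2).
  have -> : hat x1 x2 x3 x * \1_(`]x2, x3[%classic) x = (x3 - x + ramp x3 x) / (x3 - x2).
    rewrite hat_right ?(ltW x2x)// indicE.
    have [xx3|x3x] := ltP x x3; first by rewrite mem_set ?mulr1//= in_itv/= x2x.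
    rewrite memNset ?mulr0; last by rewrite /= in_itv/= => /andP[_]; lra.
    by rewrite /ramp max_l ?subr_ge0// addrA subrK subrr mul0r.
  have C : (m3 k - x + ramp (m3 k) x) / (m3 k - m2 k) @[k --> \oo] -->
      (x3 - x + ramp x3 x) / (x3 - x2).
    apply: cvgM; last by apply: cvgV; [rewrite subr_eq0 gt_eqF|exact: cvgB].
    by apply: cvgD; [apply: cvgB => //; exact: cvg_cst|exact: cvg_ramp].
  apply: cvg_trans C; apply: near_eq_cvg.
  have /cvgr_lt/(_ _ x2x) := c2; apply: filterS => k /ltW m2x.
  by rewrite hat_right.
rewrite indicE memNset; last by rewrite /= in_itv/= => /andP[+ _]; lra.
rewrite mulr0; apply: cvg_near_cst.
have /cvgr_gt/(_ _ xx2') := c1; apply: filterS => k xm1.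
by rewrite hat_outside// (ltW xm1).
Qed.

Section sequences.
Variables (p q : R) (u s : R -> R).
Let D : set R := `]p, q[%classic.
Hypothesis sg : subgradient D u s.
Hypothesis cs : left_continuous D s.
Hypothesis mol : forall e : R, 0 < e -> exists eta, left_mollifier e eta.

Let mD : measurable D. Proof. exact: measurable_itv. Qed.
Let oD : open D. Proof. exact: interval_open. Qed.
Let Dfin : (mu D < +oo)%E.
Proof. by rewrite lebesgue_measure_itv/=; case: ifP; rewrite -?EFinB ltry. Qed.

Lemma tent_sequence (z1 z2 z3 : nat -> R) :
  (forall k, [/\ increases_across p q s (z1 k), increases_across p q s (z2 k) & increases_across p q s (z3 k)]) ->
  (forall k, z1 k < z2 k < z3 k) ->
  exists (m1 m2 m3 : nat -> R) (f g : nat -> R -> R), forall k, let e := k.+1%:R^-1 in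
  [/\ [/\ m1 k < m2 k, m2 k < m3 k, `|m1 k - z1 k| <= e, `|m2 k - z2 k| <= e & `|m3 k - z3 k| <= e],
      left_primitive (f k) (g k), admissible p q u (f k),
      (forall x, `|f k x - hat (m1 k) (m2 k) (m3 k) x| <= e) &
      (forall x, e < `|x - z1 k| -> e < `|x - z2 k| -> e < `|x - z3 k| ->
         g k x = tent (m1 k) (m2 k) (m3 k) (m1 k < x)%R%:R (m2 k < x)%R%:R (m3 k < x)%R%:R) /\
      (forall x, `|g k x| <= 4 * ((z2 k - z1 k)^-1 + (z3 k - z2 k)^-1))].
Proof.
move=> sz zz.
have H k : 0 < k.+1%:R^-1 :> R by rewrite invr_gt0.
have /choice[m1] : forall k, exists m1, _ := fun k =>
  let: And3 s1 s2 s3 := sz k in let: conj z12 z23 := andP (zz k) in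
  tent_approximation sg cs mol s1 s2 s3 z12 z23 (H k).
by move=> /choice[m2 /choice[m3 /choice[f /choice[g fg]]]]; exists m1, m2, m3, f, g.
Qed.

(** The limit h is allowed to be discontinuous at x2, where the hats need not
    converge. *)
Lemma tent_sequence_L1 (z1 z2 z3 : nat -> R) (h : R -> R) (x2 : R) :
  (forall k, [/\ increases_across p q s (z1 k), increases_across p q s (z2 k) & increases_across p q s (z3 k)]) ->
  (forall k, z1 k < z2 k < z3 k) ->
  measurable_fun setT h -> (forall x, `|h x| <= 1) ->
  (forall m1 m2 m3 : nat -> R, (forall k, [/\ m1 k < m2 k, m2 k < m3 k,
      `|m1 k - z1 k| <= k.+1%:R^-1, `|m2 k - z2 k| <= k.+1%:R^-1 & `|m3 k - z3 k| <= k.+1%:R^-1]) ->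
    forall x, x != x2 -> hat (m1 k) (m2 k) (m3 k) x @[k --> \oo] --> h x) ->
  exists phi_, (forall k, admissible p q u (phi_ k)) /\ Lp_cvg D 1%E phi_ h.
Proof.
move=> sz zz mh h1 hath; have [m1 [m2 [m3 [f [g fgP]]]]] := tent_sequence sz zz.
exists f; split; first by move=> k; have [] := fgP k.
have mP k : [/\ m1 k < m2 k, m2 k < m3 k, `|m1 k - z1 k| <= k.+1%:R^-1,
    `|m2 k - z2 k| <= k.+1%:R^-1 & `|m3 k - z3 k| <= k.+1%:R^-1] by have [] := fgP k.
have fh k x : `|f k x - hat (m1 k) (m2 k) (m3 k) x| <= 1 / k.+1%:R.
  by rewrite div1r; have [] := fgP k.
apply: (@bounded_Lp_cvg _ _ mD Dfin _ _ f h 2) => //.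
- by move=> k; have [_ fg _ _ _] := fgP k; exact: left_primitive_measurable fg.
- move=> k x; have [m12 m23 _ _ _] := mP k.
  have /andP[h0 h1'] := hat_bounds x m12 m23.
  rewrite -[f k x](subrK (hat (m1 k) (m2 k) (m3 k) x)) (le_trans (ler_normD _ _))//.
  rewrite [leRHS](_ : _ = 1 + 1)//; apply: lerD; last by rewrite ger0_norm.
  by rewrite (le_trans (fh k x))// ler_pdivrMr// mul1r ler1n.
- by move=> x; rewrite (le_trans (h1 x))// ler1n.
- apply: (ae_off_countable (A := [set x2])); first exact: countable1.
  move=> x /eqP xx2 _.
  rewrite -[h x]add0r (_ : f ^~ x = fun k => (f k x - hat (m1 k) (m2 k) (m3 k) x) +
    hat (m1 k) (m2 k) (m3 k) x); last by apply/funext => k; rewrite subrK.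
  apply: cvgD; last exact: hath.
  by apply: (@cvg_harmonic_bound _ 0 1) => k; rewrite subr0.
Qed.

Lemma tent_sequence_H1 (x1 x2 x3 : R) : increases_across p q s x1 -> increases_across p q s x2 ->
  increases_across p q s x3 -> x1 < x2 -> x2 < x3 ->
  exists phi_, (forall k, admissible p q u (phi_ k)) /\ H1_cvg D phi_ (hat x1 x2 x3).
Proof.
move=> s1 s2 s3 x12 x23.
have [||m1 [m2 [m3 [f [g fgP]]]]] := @tent_sequence (cst x1) (cst x2) (cst x3).
- by [].
- by move=> k /=; rewrite x12.
have fg k : left_primitive (f k) (g k) by have [] := fgP k.
have m12 k : m1 k < m2 k by have [[]] := fgP k.
have m23 k : m2 k < m3 k by have [[]] := fgP k.
have d1 k : `|m1 k - x1| <= 1 / k.+1%:R by rewrite div1r; have [[]] := fgP k.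
have d2 k : `|m2 k - x2| <= 1 / k.+1%:R by rewrite div1r; have [[]] := fgP k.
have d3 k : `|m3 k - x3| <= 1 / k.+1%:R by rewrite div1r; have [[]] := fgP k.
have c1 := cvg_harmonic_bound d1; have c2 := cvg_harmonic_bound d2.
have c3 := cvg_harmonic_bound d3.
have fh k x : `|f k x - hat (m1 k) (m2 k) (m3 k) x| <= 1 / k.+1%:R.
  by rewrite div1r; have [] := fgP k.
have f2 k x : `|f k x| <= 2.
  have /andP[h0 h1'] := hat_bounds x (m12 k) (m23 k).
  rewrite -[f k x](subrK (hat (m1 k) (m2 k) (m3 k) x)) (le_trans (ler_normD _ _))//.
  rewrite [leRHS](_ : _ = 1 + 1)//; apply: lerD; last by rewrite ger0_norm.
  by rewrite (le_trans (fh k x))// ler_pdivrMr// mul1r ler1n.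
have h2 x : `|hat x1 x2 x3 x| <= 2.
  by have /andP[h0 h1'] := hat_bounds x x12 x23; rewrite ger0_norm// (le_trans h1')// ler1n.
pose K := 4 * ((x2 - x1)^-1 + (x3 - x2)^-1).
have gK k x : `|g k x| <= K by have [_ _ _ _ []] := fgP k.
pose gh x := tent x1 x2 x3 (x1 < x)%R%:R (x2 < x)%R%:R (x3 < x)%R%:R.
have hgh : left_primitive (hat x1 x2 x3) gh by exact: hat_left_primitive.
have ghK x : `|gh x| <= K.
  apply: le_trans (ler_norm_tent (k := 1) x12 x23 _ _ _) _.
  - by case: (x1 < x); rewrite ?normr1 ?normr0.
  - by case: (x2 < x); rewrite ?normr1 ?normr0.
  - by case: (x3 < x); rewrite ?normr1 ?normr0.
  rewrite /K ler_wpM2r ?addr_ge0 ?invr_ge0 ?subr_ge0 ?ltW//.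
  by lra.
exists f; split; first by move=> k; have [] := fgP k.
split.
  apply: (@bounded_Lp_cvg _ _ mD Dfin _ _ f _ 2) => //.
  - by move=> k; exact: left_primitive_measurable (fg k).
  - exact: left_primitive_measurable hgh.
  - apply: aeW => x _; rewrite hatE// -[tent _ _ _ _ _ _]add0r.
    rewrite (_ : f ^~ x = fun k => (f k x - hat (m1 k) (m2 k) (m3 k) x) +
      hat (m1 k) (m2 k) (m3 k) x); last by apply/funext => k; rewrite subrK.
    apply: cvgD; first by apply: (@cvg_harmonic_bound _ 0 1) => k; rewrite subr0.
    under eq_cvg do rewrite hatE//.
    by apply: cvg_tent => //; exact: cvg_ramp.
exists g, gh; split.
- by move=> k; apply: left_primitive_weak_derivative => //; exists 2.
- by apply: left_primitive_weak_derivative => //; exists 2.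
apply: (@bounded_Lp_cvg _ _ mD Dfin _ _ g _ K) => //.
- by move=> k; exact: left_primitive_measurable_derivative (fg k).
- exact: left_primitive_measurable_derivative hgh.
apply: (ae_off_countable (A := [set x1; x2; x3])); first exact: finite_set_countable.
move=> x nx _.
have step (m_ : nat -> R) (y : R) : (forall k, `|m_ k - y| <= 1 / k.+1%:R) -> x != y ->
    \forall k \near \oo, k.+1%:R^-1 < `|x - y| /\ (m_ k < x)%R = (y < x)%R.
  move=> my xy; have xy0 : 0 < `|x - y| by rewrite normr_gt0 subr_eq0.
  near=> k.
  have kxy : k.+1%:R^-1 < `|x - y| by near: k; exact: near_infty_natSinv_lt (PosNum xy0).
  split=> //; have := my k; rewrite div1r ler_distl; move: kxy; set t := _^-1.
  have [yx|xy'|xy'] := ltgtP y x; last by rewrite xy' eqxx in xy.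
    by rewrite gtr0_norm ?subr_gt0// => ? /andP[? ?]; lra.
  rewrite ltr0_norm ?subr_lt0// => ? /andP[? ?].
  by apply/negbTE; rewrite -leNgt; lra.
have xx1 : x != x1 by apply/eqP => xx; apply: nx; left; left.
have xx2 : x != x2 by apply/eqP => xx; apply: nx; left; right.
have xx3 : x != x3 by apply/eqP => xx; apply: nx; right.
have C : tent (m1 k) (m2 k) (m3 k) (x1 < x)%R%:R (x2 < x)%R%:R (x3 < x)%R%:R @[k --> \oo] --> gh x.
  by apply: cvg_tent => //; exact: cvg_cst.
apply: cvg_trans C; apply: near_eq_cvg; near=> k.
have [e1 b1] : k.+1%:R^-1 < `|x - x1| /\ (m1 k < x)%R = (x1 < x)%R.
  by near: k; exact: step.
have [e2 b2] : k.+1%:R^-1 < `|x - x2| /\ (m2 k < x)%R = (x2 < x)%R.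
  by near: k; exact: step.
have [e3 b3] : k.+1%:R^-1 < `|x - x3| /\ (m3 k < x)%R = (x3 < x)%R.
  by near: k; exact: step.
by have [_ _ _ _ [-> // _]] := fgP k; rewrite b1 b2 b3.
Unshelve. all: by end_near. Qed.

End sequences.
End limits.

(** * The two assertions *)

Lemma limit_point_sequence (R : realType) (A : set R) (x a b : R) :
  limit_point A x -> a < x -> x < b ->
  exists y : nat -> R, forall k, [/\ y k != x, A (y k), a < y k, y k < b &
    `|y k - x| <= k.+1%:R^-1].
Proof.
move=> lx ax xb.
suff /choice[y yP] : forall k : nat, exists y : R,
    [/\ y != x, A y, a < y, y < b & `|y - x| <= k.+1%:R^-1] by exists y.
move=> k; have n0 : 0 < k.+1%:R^-1 :> R by rewrite invr_gt0.
have [|y [yx Ay [abs yk]]] := lx (`]a, b[%classic `&` ball x k.+1%:R^-1).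
  apply: filterI; last exact: nbhsx_ballx.
  by apply: open_nbhs_nbhs; split; [exact: interval_open|rewrite /= in_itv/= ax].
exists y; move: abs; rewrite /= in_itv/= => /andP[ay yb]; split=> //.
by rewrite distrC ltW.
Qed.

Theorem proposition3p2 (R : realType) (sigma : R) (u : R -> R) (x1 x2 x3 : R) :
  let I : set R := `]0, sigma[%classic in
  let supp_u2 := distribution_support I (second_derivative I u) in
  0 < sigma ->
  W1p I +oo%E u ->
  convex_on I u ->
  [set x1; x2; x3] `<=` supp_u2 ->
  0 < x1 -> x1 < x2 -> x2 < x3 -> x3 < sigma ->
  (exists phi_ : nat -> R -> R,
     (forall k, [/\ H1_0 I (phi_ k), preserves_convexity I u (phi_ k) &
                    compactly_supported I (phi_ k)]) /\
     H1_cvg I phi_ (hat x1 x2 x3)) /\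
  (limit_point supp_u2 x2 ->
   exists phi_m phi_p : nat -> R -> R,
     [/\ forall k, [/\ H1_0 I (phi_m k), preserves_convexity I u (phi_m k) &
                       compactly_supported I (phi_m k)],
         forall k, [/\ H1_0 I (phi_p k), preserves_convexity I u (phi_p k) &
                       compactly_supported I (phi_p k)],
         Lp_cvg I 1%E phi_m (fun x => hat x1 x2 x3 x * \1_(`]x1, x2[%classic) x)
       & Lp_cvg I 1%E phi_p (fun x => hat x1 x2 x3 x * \1_(`]x2, x3[%classic) x)]).
Proof.
move=> I supp_u2 sigma0 _ cu suppx x10 x12 x23 x3s.
have [s sg cs] := convex_subgradient cu.
have strict x : supp_u2 x -> increases_across 0 sigma s x.
  move=> sx; have [] := sx; rewrite /I/= in_itv/= => /andP[x0 xs] _.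
  split=> // a b a0 ax xb bs.
  by apply: (support_subgradient_lt sg sx) => //; rewrite /= in_itv/=; apply/andP; split; lra.
have sx1 : supp_u2 x1 by apply: suppx; left; left.
have sx2 : supp_u2 x2 by apply: suppx; left; right.
have sx3 : supp_u2 x3 by apply: suppx; right.
have mol := support_mollifier sx1.
split.
  have [phi [phiP phic]] := tent_sequence_H1 sg cs mol (strict _ sx1) (strict _ sx2) (strict _ sx3) x12 x23.
  by exists phi.
move=> lx2.
have [y yP] := limit_point_sequence lx2 x12 x23.
(* The approximating points may lie on either side of x2; z k < w k are always
   two distinct points of the support that tend to x2. *)
pose z k := Num.min (y k) x2; pose w k := Num.max (y k) x2.
have zw k : z k < w k.
  by have [yx _ _ _ _] := yP k; rewrite gt_min !lt_max !ltxx orbF /= -neq_lt.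
have sz k : increases_across 0 sigma s (z k).
  by have [_ ? _ _ _] := yP k; rewrite /z; case: ltP => _; exact: strict.
have sw k : increases_across 0 sigma s (w k).
  by have [_ ? _ _ _] := yP k; rewrite /w; case: ltP => _; exact: strict.
have x1z k : x1 < z k by have [_ _ ? _ _] := yP k; rewrite lt_min x12 andbT.
have wx3 k : w k < x3 by have [_ _ _ ? _] := yP k; rewrite gt_max x23 andbT.
have zx2 k : `|z k - x2| <= k.+1%:R^-1.
  have [_ _ _ _ yk] := yP k; rewrite /z; case: (ltP (y k) x2) => _ //.
  by rewrite subrr normr0 invr_ge0.
have wx2 k : `|w k - x2| <= k.+1%:R^-1.
  have [_ _ _ _ yk] := yP k; rewrite /w; case: (ltP (y k) x2) => _ //.
  by rewrite subrr normr0 invr_ge0.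
have two (m_ v : nat -> R) (x : R) : (forall k, `|m_ k - v k| <= k.+1%:R^-1) ->
    (forall k, `|v k - x| <= k.+1%:R^-1) -> m_ k @[k --> \oo] --> x.
  move=> mv vx; apply: (@cvg_harmonic_bound _ _ _ 2) => k.
  rewrite -[m_ k](subrK (v k)) -addrA (le_trans (ler_normD _ _))//.
  by rewrite [leRHS](_ : _ = k.+1%:R^-1 + k.+1%:R^-1) ?lerD//; ring.
have one (x : R) k : `|cst x k - x| <= k.+1%:R^-1 by rewrite subrr normr0 invr_ge0.
have mI (a b : R) : measurable `]a, b[%classic by exact: measurable_itv.
have [| | | | | phi_m [phi_mP phi_mc]] := tent_sequence_L1 sg cs mol (z1 := cst x1) (z2 := z)
   (z3 := w) (h := fun x => hat x1 x2 x3 x * \1_(`]x1, x2[%classic) x) (x2 := x2).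
- by move=> k; split=> //; exact: strict.
- by move=> k; rewrite x1z zw.
- exact: hat_indicator_measurable.
- by move=> x; exact: hat_indicator_bounded.
- move=> m1 m2 m3 mP x xx2.
  apply: cvg_hat_left => //.
  + by move=> k; have [] := mP k.
  + by move=> k; have [] := mP k.
  + by apply: (two _ (cst x1)) => k; [have [] := mP k|exact: one].
  + by apply: (two _ z) => k; [have [] := mP k|exact: zx2].
  + by apply: (two _ w) => k; [have [] := mP k|exact: wx2].
have [| | | | | phi_p [phi_pP phi_pc]] := tent_sequence_L1 sg cs mol (z1 := z) (z2 := w)
   (z3 := cst x3) (h := fun x => hat x1 x2 x3 x * \1_(`]x2, x3[%classic) x) (x2 := x2).
- by move=> k; split=> //; exact: strict.
- by move=> k; rewrite zw wx3.
- exact: hat_indicator_measurable.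
- by move=> x; exact: hat_indicator_bounded.
- move=> m1 m2 m3 mP x xx2.
  apply: cvg_hat_right => //.
  + by move=> k; have [] := mP k.
  + by move=> k; have [] := mP k.
  + by apply: (two _ z) => k; [have [] := mP k|exact: zx2].
  + by apply: (two _ w) => k; [have [] := mP k|exact: wx2].
  + by apply: (two _ (cst x3)) => k; [have [] := mP k|exact: one].
by exists phi_m, phi_p; split.
Qed.
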